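(* Let $k$ be a field of characteristic zero and let $f\in k[x,y,z]$ be such that $A=k[x,y,z]/(f)$ is isomorphic, as a $k$-algebra, to a polynomial ring in two variables over $k$, and such that for some $a\in k$ the polynomial $f(x,y,a)$ is a coordinate in $k[x,y]$. Then $f$ is a $k[z]$-coordinate in $k[x,y,z]=k[z][x,y]$.
   Context: For a commutative ring $S$, a polynomial $g\in S[x,y]$ is called a coordinate (or $S$-coordinate) of $S[x,y]$ if there exists $h\in S[x,y]$ such that the $S$-algebra endomorphism of $S[x,y]$ sending $x\mapsto g$, $y\mapsto h$ is an automorphism, i.e. $S[g,h]=S[x,y]$. ''Coordinate in $k[x,y]$'' is the case $S=k$; ''$k[z]$-coordinate in $k[x,y,z]$'' is the case $S=k[z]$, with $k[x,y,z]$ viewed as $k[z][x,y]$. *)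

(* Defs.v *)
From HB Require Import structures.
From mathcomp Require Import all_boot all_algebra.
From mathcomp Require Import generic_quotient ring_quotient.
From mathcomp Require Import mpoly.
From mathcomp Require boolp.

Set Implicit Arguments.
Unset Strict Implicit.
Unset Printing Implicit Defensive.

Import GRing.Theory.
Local Open Scope ring_scope.
Local Open Scope quotient_scope.

(* The library's ring quotient only covers proper ideals with boolean         *)
(* membership. Here A/(f) is built for every f (it is the zero ring when f is *)
(* a unit) on top of the library's quotient of a zmodType by a subgroup.      *)
Section PrincipalQuotient.
Variables (K : comNzRingType) (A : comAlgType K) (f : A).

Definition principal_ideal : {pred A} :=
  fun g => boolp.asbool (exists q : A, g = q * f).

Lemma principal_idealP g :
  reflect (exists q : A, g = q * f) (g \in principal_ideal).
Proof. exact: boolp.asboolP. Qed.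

Lemma principal_ideal_zmod_closed : zmod_closed principal_ideal.
Proof.
split=> [|u v /principal_idealP[p ->] /principal_idealP[q ->]].
  by apply/principal_idealP; exists 0; rewrite mul0r.
by apply/principal_idealP; exists (p - q); rewrite mulrBl.
Qed.

HB.instance Definition _ :=
  GRing.isZmodClosed.Build A principal_ideal principal_ideal_zmod_closed.

Lemma principal_idealMl g u : u \in principal_ideal -> g * u \in principal_ideal.
Proof.
by move=> /principal_idealP[q ->]; apply/principal_idealP; exists (g * q);
  rewrite mulrA.
Qed.

Definition principal_quot : Type := Quotient.quot principal_ideal.

HB.instance Definition _ := GRing.Zmodule.on principal_quot.
HB.instance Definition _ : EqQuotient A (Quotient.equiv principal_ideal)
  principal_quot := EqQuotient.on principal_quot.
HB.instance Definition _ := isZmodQuotient.Build A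
  (Quotient.equiv principal_ideal) 0 -%R +%R principal_quot
  (@pi_zeror _ _ _ _ _ (Quotient.quot principal_ideal))
  (@pi_oppr _ _ _ _ _ (Quotient.quot principal_ideal))
  (@pi_addr _ _ _ _ _ (Quotient.quot principal_ideal)).

Lemma principal_quotE (u v : A) :
  (u == v %[mod principal_quot]) = (u - v \in principal_ideal).
Proof. by rewrite -Quotient.idealrBE. Qed.

Definition pquot_one : principal_quot := lift_cst principal_quot 1.
Definition pquot_mul := lift_op2 principal_quot *%R.
Definition pquot_scale (c : K) := lift_op1 principal_quot ( *:%R c).

Canonical pi_pquot_one_morph := PiConst pquot_one.

Lemma pi_pquot_mul : {morph \pi : u v / u * v >-> pquot_mul u v}.
Proof.
move=> u v; unlock pquot_mul; apply/eqP; rewrite principal_quotE.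
set u' := repr _; set v' := repr _.
have Hu : u - u' \in principal_ideal by rewrite -principal_quotE reprK.
have Hv : v - v' \in principal_ideal by rewrite -principal_quotE reprK.
have -> : u * v - u' * v' = v * (u - u') + u' * (v - v').
  by rewrite !mulrBr addrA [v * u]mulrC [v * u']mulrC subrK.
by rewrite rpredD ?principal_idealMl.
Qed.
Canonical pi_pquot_mul_morph := PiMorph2 pi_pquot_mul.

Lemma pi_pquot_scale c : {morph \pi : u / c *: u >-> pquot_scale c u}.
Proof.
move=> u; unlock pquot_scale; apply/eqP; rewrite principal_quotE -scalerBr.
by rewrite -[_ - _]mul1r scalerAl principal_idealMl // -principal_quotE reprK.
Qed.
Canonical pi_pquot_scale_morph c := PiMorph1 (pi_pquot_scale c).

Fact pquot_mulA : associative pquot_mul.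
Proof. by move=> u v w; rewrite -[u]reprK -[v]reprK -[w]reprK !piE mulrA. Qed.

Fact pquot_mulC : commutative pquot_mul.
Proof. by move=> u v; rewrite -[u]reprK -[v]reprK !piE mulrC. Qed.

Fact pquot_mul1 : left_id pquot_one pquot_mul.
Proof. by move=> u; rewrite -[u]reprK !piE mul1r. Qed.

Fact pquot_mulDl : left_distributive pquot_mul +%R.
Proof.
by move=> u v w; rewrite -[u]reprK -[v]reprK -[w]reprK !piE mulrDl.
Qed.

HB.instance Definition _ := GRing.Zmodule_isComPzRing.Build principal_quot
  pquot_mulA pquot_mulC pquot_mul1 pquot_mulDl.

Fact pquot_scaleA a b u : pquot_scale a (pquot_scale b u) = pquot_scale (a * b) u.
Proof. by rewrite -[u]reprK !piE scalerA. Qed.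

Fact pquot_scale1 : left_id 1 pquot_scale.
Proof. by move=> u; rewrite -[u]reprK !piE scale1r. Qed.

Fact pquot_scaleDr : right_distributive pquot_scale +%R.
Proof. by move=> a u v; rewrite -[u]reprK -[v]reprK !piE scalerDr. Qed.

Fact pquot_scaleDl u : {morph pquot_scale^~ u : a b / a + b}.
Proof. by move=> a b; rewrite -[u]reprK !piE scalerDl. Qed.

HB.instance Definition _ := GRing.Zmodule_isLmodule.Build K principal_quot
  pquot_scaleA pquot_scale1 pquot_scaleDr pquot_scaleDl.

Lemma principal_quot_scaleAl (c : K) (u v : principal_quot) :
  c *: (u * v) = (c *: u) * v.
Proof.
rewrite -[u]reprK -[v]reprK.
by rewrite /GRing.scale /GRing.mul /= !piE scalerAl.
Qed.

End PrincipalQuotient.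

Arguments principal_quot {K A} f.

(* The library's algebra structures exclude the zero ring, hence a ring       *)
(* isomorphism that commutes with scalars instead of {lrmorphism _ -> _}.     *)
Definition quot_iso_alg (K : comNzRingType) (A : comAlgType K) (f : A)
    (B : comAlgType K) : Prop :=
  exists phi : {rmorphism principal_quot f -> B}, scalable phi /\ bijective phi.

(* In {mpoly S[2]}, x is 'X_ord0 and y is 'X_ord_max. *)
Definition is_coordinate (S : comNzRingType) (g : {mpoly S[2]}) : Prop :=
  exists h : {mpoly S[2]},
    bijective (fun p : {mpoly S[2]} => p \mPo [tuple g; h]).

(* In {mpoly k[3]}, the variables of index 0, 1, 2 are x, y, z. *)
Definition eval_z (k : comNzRingType) (a : k) (f : {mpoly k[3]}) :
    {mpoly k[2]} :=
  f \mPo [tuple 'X_ord0; 'X_ord_max; a%:MP].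

(* The identification of k[x,y,z] with k[z][x,y]. *)
Definition as_kz_xy (k : comNzRingType) (f : {mpoly k[3]}) :
    {mpoly {poly k}[2]} :=
  mmap (@mpolyC 2 {poly k} \o polyC) (tnth [tuple 'X_ord0; 'X_ord_max; 'X%:MP]) f.

(* Main.v *)
Require Import Defs.
From HB Require Import structures.
From mathcomp Require Import all_boot all_order all_algebra.
From mathcomp Require Import generic_quotient qpoly qfpoly.
From mathcomp Require Import zify ring boolp mpoly.

(** The theorem rests on the Abhyankar-Moh-Suzuki theorem over a field [F] of
    characteristic zero, in the following form: if [F[f, g] = F[t]] and [f] is
    not constant, then some [g + b(f)] has degree smaller than [deg f]
    ([embedding_reduction]). By induction on degrees, a line embedded in the
    plane is then straightened by triangular substitutions
    ([line_rectifiable]), so a generator of the kernel of a surjection from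
    [F[x, y]] to [F[t]] is a coordinate ([line_coordinate]).

    The reduction of the degree comes from two facts. Put [n = deg f], and let
    [P] be the monic equation of degree [n] of [g] over [F[f]].

    - Among the polynomials in [g] over [F(f)] of degree at most [n - 2], none
      has a [t]-degree congruent to [-1] modulo [n] ([value_gap]). Indeed
      [F[t]] is free over [F[f]] on the powers of [t] below [n] and on those of
      [g]. Each of the two linear forms that read off the last coordinate
      generates the dual of [F[t]], so that they differ by a unit of [F[t]],
      which is a constant ([top_forms_unit_multiple]). The second form
      vanishes on the powers [g ^ j] with [j <= n - 2], hence so does the
      first.

    - The degree in [t] is a valuation on [F(x)[y]/(P)], where [x] and [y] act
      as [f] and [g]. Its key polynomials, which a priori have coefficients in
      [F(x)], can be taken to be approximate roots of [P], and these have
      coefficients in [F[x]] because integers are invertible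
      ([approximate_root_value], [key_tower]). So their values are degrees of
      elements of [F[t]] and cannot be negative.

    A product of key polynomials is monic of degree [n - 1] in [y], and by the
    first fact its value is [n - 1]. As all the factors have nonnegative values,
    the value of the first key polynomial [y + b(x)] is at most [n - 1], which
    is the claim.

    In the situation of the theorem, the quotient of [A] by [z - a] is the
    coordinate ring of the line [f(x, y, a) = 0]. So [z - a] is a coordinate of
    the plane with ring [A], and [A = k[z][w]]: the polynomial [f] generates
    the kernel of a surjection from [k[z][x, y]] to [k[z][w]]
    ([family_of_lines]). Over [k(z)] this gives a mate [h] of [f], which can be
    taken in [k[z][x, y]], and [x], [y] are polynomials in [f] and [h] up to a
    denominator in [k[z]]. The denominator is removed one prime [q] at a time
    ([descent]). Either [q] divides both expressions and cancels, or [f] and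
    [h] are algebraically dependent modulo [q]. As [f = 0] is still a line
    modulo [q], the reduction of [h] is then a polynomial [c] in that of [f]
    ([dependent_in_pencil]), and [h] is replaced by [(h - c(f)) / q]. The image
    of [h] in [k[z][w]] is linear in [w] and its leading coefficient loses the
    factor [q], so the process stops. *)

Set Implicit Arguments.
Unset Strict Implicit.
Unset Printing Implicit Defensive.

Import Order.TTheory GRing.Theory Num.Theory.
Local Open Scope ring_scope.
Local Notation tofrac := (@FracField.tofrac _).
Local Notation "x %:F" := (FracField.tofrac x).

(** * Evaluation of polynomials *)
Section Evaluation.
Variables (R A : comNzRingType) (sigma : {rmorphism R -> A}) (y : A).
Definition eval_map (h : {poly R}) : A := (map_poly sigma h).[y].
HB.instance Definition _ := GRing.RMorphism.copy eval_map
  (horner_eval y \o map_poly sigma).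

Lemma eval_mapD h1 h2 : eval_map (h1 + h2) = eval_map h1 + eval_map h2. Proof. exact: rmorphD. Qed.
Lemma eval_mapM h1 h2 : eval_map (h1 * h2) = eval_map h1 * eval_map h2. Proof. exact: rmorphM. Qed.
Lemma eval_mapC c : eval_map c%:P = sigma c.
Proof. by rewrite /eval_map map_polyC hornerC. Qed.
Lemma eval_mapX : eval_map 'X = y.
Proof. by rewrite /eval_map map_polyX hornerX. Qed.
Lemma eval_mapXn i : eval_map 'X^i = y ^+ i.
Proof. by rewrite /eval_map map_polyXn hornerXn. Qed.
Lemma eval_mapZ c h : eval_map (c *: h) = sigma c * eval_map h.
Proof. by rewrite /eval_map map_polyZ hornerZ. Qed.

Lemma eval_map_coef n (h : {poly R}) : (size h <= n)%N -> eval_map h = \sum_(i < n) sigma h`_i * y ^+ i.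
Proof.
move=> hs; rewrite /eval_map (@horner_coef_wide _ n); last first.
  exact: leq_trans (size_poly _ _) hs.
by apply: eq_bigr => i _; rewrite coef_map.
Qed.
End Evaluation.

Lemma rmorph_eval_map (R A B : comNzRingType) (sigma : {rmorphism R -> A})
    (rho : {rmorphism A -> B}) (tau : {rmorphism R -> B}) (y : A) (h : {poly R}) :
  (forall c, rho (sigma c) = tau c) -> rho (eval_map sigma y h) = eval_map tau (rho y) h.
Proof.
move=> e; rewrite /eval_map -horner_map /= -map_poly_comp; congr (_.[_]).
exact: eq_map_poly.
Qed.

Definition polyCC (S : comNzRingType) (c : S) : {poly {poly S}} := c%:P%:P.
HB.instance Definition _ (S : comNzRingType) :=
  GRing.RMorphism.copy (@polyCC S) (polyC \o polyC).

(** * Approximate roots *)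
Section ApproxRoot.
Variable R : comNzRingType.
Implicit Types P Q M b : {poly R}.

Lemma size_monic_exp M s i : M \is monic -> size M = s.+1 ->
  size (M ^+ i) = (i * s).+1.
Proof.
move=> Mm Ms; elim: i => [|i IH]; first by rewrite expr0 size_poly1.
rewrite exprS size_monicM ?monic_exp // ?IH ?Ms; first by rewrite addSn /= mulSn addnS.
by rewrite -size_poly_eq0 IH.
Qed.

Lemma monic_coef M s : M \is monic -> size M = s.+1 -> M`_s = 1.
Proof. by move=> /monicP; rewrite lead_coefE => + Ms; rewrite Ms. Qed.

Lemma size_sub_monic P Q s : P \is monic -> Q \is monic ->
  size P = s.+1 -> size Q = s.+1 -> (size (P - Q)%R <= s)%N.
Proof.
move=> Pm Qm Ps Qs; apply/leq_sizeP => j; rewrite leq_eqVlt => /orP[/eqP<-|sj].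
  by rewrite coefB (monic_coef Pm Ps) (monic_coef Qm Qs) subrr.
by rewrite coefB !nth_default ?subrr ?Ps ?Qs.
Qed.

Lemma monicD_small M b s : M \is monic -> size M = s.+1 -> (size b <= s)%N ->
  M + b \is monic /\ size (M + b) = s.+1.
Proof.
move=> Mm Ms bs; split; last by rewrite size_polyDl Ms.
by apply/monicP; rewrite lead_coefDl ?Ms //; apply/monicP.
Qed.

Lemma coef_mul_top P Q i j : (size P <= i.+1)%N -> (size Q <= j.+1)%N ->
  (P * Q)`_(i + j) = P`_i * Q`_j.
Proof.
move=> Ps Qs; rewrite coefM.
have ilt : (i < (i + j).+1)%N by rewrite ltnS leq_addr.
rewrite (bigD1 (Ordinal ilt)) //= addKn big1 ?addr0 // => k ki.
have {}ki : k != i :> nat by apply: contra ki => /eqP e; apply/eqP/val_inj.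
case: (ltngtP k i) ki => // ki _.
  by rewrite [Q`_ _]nth_default ?mulr0 //; apply: leq_trans Qs _; lia.
by rewrite [P`_ _]nth_default ?mul0r //; apply: leq_trans Ps _.
Qed.

(** A change of [M] by [b] changes [M ^+ E] by [b] times a polynomial of leading
    coefficient [E]: when [E] is invertible, the coefficients of the [E]-th power
    can be prescribed one after the other from the top. *)
Lemma sub_expr_monic Q M s E : (0 < E)%N -> Q \is monic -> M \is monic ->
    size Q = s.+1 -> size M = s.+1 ->
  exists S : {poly R}, [/\ Q ^+ E - M ^+ E = (Q - M) * S,
    (size S <= (E.-1 * s).+1)%N & S`_(E.-1 * s) = E%:R].
Proof.
move=> E0 Qm Mm Qs Ms; rewrite subrXX.
set S := \sum_(i < E) _; exists S.
have T (i : 'I_E) : Q ^+ (E.-1 - i) * M ^+ i \is monic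
    /\ size (Q ^+ (E.-1 - i) * M ^+ i) = (E.-1 * s).+1.
  have iE := ltn_ord i.
  split; first by rewrite monicMl ?monic_exp.
  rewrite size_monicM ?monic_exp ?monic_neq0 ?monic_exp //.
  rewrite !(size_monic_exp _ _ Qs) // !(size_monic_exp _ _ Ms) //.
  by rewrite addSn addnS /= -mulnDl subnK //; lia.
split=> //.
- apply: (big_ind (fun p : {poly R} => (size p <= (E.-1 * s).+1)%N)).
  + by rewrite size_poly0.
  + by move=> p q ps qs; apply: leq_trans (size_polyD _ _) _; rewrite geq_max ps.
  + by move=> i _; case: (T i) => _ ->.
- rewrite coef_sum (eq_bigr (fun=> 1)) ?sumr_const ?card_ord // => i _.
  have [Tm Ts] := T i.
  exact: monic_coef Tm Ts.
Qed.

(** The coefficients of [Q] are found from the top downwards, each one from an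
    equation [E * c = a]. They give [Q ^+ E] the [s] coefficients of [P] that
    follow the leading one. *)
Lemma approximate_root P s E u : (0 < E)%N -> u * E%:R = 1 :> R ->
    P \is monic -> size P = (E * s).+1 ->
  exists Q : {poly R}, [/\ Q \is monic, size Q = s.+1 &
    (size (P - Q ^+ E)%R <= E.-1 * s)%N].
Proof.
move=> E0 uE Pm Ps.
suff H i : (i <= s)%N -> exists Q : {poly R}, [/\ Q \is monic, size Q = s.+1 &
    (size (P - Q ^+ E)%R <= E.-1 * s + i)%N].
  by have := H 0 isT; rewrite addn0.
move=> ile; rewrite -(subKn ile); elim: (s - i)%N (leq_subr i s) => {i ile}[_|j IH js].
  exists 'X^s; rewrite monicXn size_polyXn subn0; split=> //.
  rewrite -exprM mulnC.
  have -> : (E.-1 * s + s = E * s)%N by rewrite addnC -mulSn prednK.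
  by apply: size_sub_monic => //; rewrite ?monicXn ?size_polyXn.
have [Q [Qm Qs Qb]] := IH (ltnW js).
set i := (s - j.+1)%N; have si : (s - j = i.+1)%N by rewrite /i; lia.
rewrite si addnS in Qb.
set a := (P - Q ^+ E)`_(E.-1 * s + i).
have bs : (size ((u * a) *: 'X^i) <= i.+1)%N.
  by apply: leq_trans (size_scale_leq _ _) _; rewrite size_polyXn.
have isl : (i < s)%N by rewrite /i; lia.
have [Q'm Q's] := monicD_small Qm Qs (leq_trans bs isl).
exists (Q + (u * a) *: 'X^i); split=> //.
have [S [e Ss Sc]] := sub_expr_monic E0 Q'm Qm Q's Qs.
have -> : P - (Q + (u * a) *: 'X^i) ^+ E = (P - Q ^+ E) - (u * a) *: 'X^i * S.
  by move: e; rewrite [Q + _ - Q]addrC addKr => <-; rewrite opprB addrA subrK.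
apply/leq_sizeP => k; rewrite leq_eqVlt => /orP[/eqP<-|sk].
  rewrite coefB -/a addnC coef_mul_top // Sc coefZ coefXn eqxx mulr1.
  by rewrite mulrAC uE mul1r subrr.
rewrite coefB (nth_default _ (leq_trans Qb sk)) nth_default ?subr0 //.
apply: leq_trans (size_polyMleq _ _) _.
have := leq_sub2r 1 (leq_add bs Ss); rewrite !subn1 addSn addnS /= => h.
by apply: leq_trans h _; rewrite addnC.
Qed.
End ApproxRoot.

(** * Multiples of an integer modulo another *)
Lemma gcd_multiple_notin (d e E : nat) (eta : int) :
    (0 < d)%N -> gcdz d eta = e -> d = (E * e)%N ->
  forall j, (0 < j < E)%N -> ~~ (d %| eta *+ j)%Z.
Proof.
move=> d0 ge de j /andP[j0 jE]; apply/negP => /dvdzP[q].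
have [u [w b]] := Bezoutz d eta; rewrite ge in b.
rewrite -mulr_natr => h.
have e0 : (e%:Z != 0) by move: d0 de; case: (e) => // ; rewrite muln0; lia.
have : (E %| j)%N.
  rewrite -[E]/`|E%:Z|%N -[X in (_ %| X)%N]/`|j%:Z|%N -dvdzE.
  rewrite -(@dvdz_mul2r e%:Z) //.
  have -> : E%:Z * e%:Z = d%:Z by rewrite -PoszM -de.
  apply/dvdzP; exists (u * j%:Z + w * q); rewrite natz in h.
  have -> : (u * j%:Z + w * q) * d%:Z = u * j%:Z * d%:Z + w * (eta * j%:Z).
    by rewrite h; ring.
  by rewrite -b; ring.
by move/dvdn_leq => /(_ j0); rewrite leqNgt jE.
Qed.

Lemma gcd_multiple_cover (d e E : nat) (eta z : int) :
    (0 < d)%N -> gcdz d eta = e -> d = (E * e)%N -> (e %| z)%Z ->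
  exists2 i, (i < E)%N & (d %| z - eta *+ i)%Z.
Proof.
move=> d0 ge de /dvdzP[q ->].
have [u [w b]] := Bezoutz d eta; rewrite ge in b.
have E0 : (0 < E)%N by move: d0; rewrite de; case: (E).
have E0' : E%:Z != 0 by case: (E) E0.
have [r er] : exists r : nat, ((q * w) %% E)%Z = r.
  by exists `|((q * w) %% E)%Z|%N; rewrite gez0_abs // modz_ge0.
exists r; first by rewrite -ltz_nat -er ltz_pmod.
have /dvdzP[t et] : (e %| eta)%Z by rewrite -ge dvdz_gcdr.
apply/dvdzP; exists (q * u + t * (q * w %/ E)%Z).
rewrite -mulr_natr natz.
have := divz_eq (q * w) E; rewrite er => h.
have -> : q * e%:Z = q * u * d%:Z + ((q * w %/ E)%Z * E%:Z + r%:Z) * eta.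
  by rewrite -h -b; ring.
by rewrite de PoszM et; ring.
Qed.

(** * Valuations and key polynomials *)
Section Valuation.
Variables (K L : fieldType) (phi : {rmorphism K -> L}) (v : L -> int).
(** The value of 0 is minus infinity, whatever [v 0] is. *)
Definition val_le (a : L) (z : int) := (a == 0) || (v a <= z).
Hypothesis vM : forall a b : L, a != 0 -> b != 0 -> v (a * b) = v a + v b.
Hypothesis vD : forall a b z, val_le a z -> val_le b z -> val_le (a + b) z.

Lemma v1 : v 1 = 0.
Proof. by have := vM (oner_neq0 L) (oner_neq0 L); rewrite mulr1; move: (v 1) => w; lia. Qed.

Lemma vN a : v (- a) = v a.
Proof.
have [->|a0] := eqVneq a 0; first by rewrite oppr0.
have n0 : (-1 : L) != 0 by rewrite oppr_eq0 oner_neq0.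
rewrite -mulN1r vM //; have := vM n0 n0; rewrite mulrNN mulr1 v1.
by move: (v (-1)) (v a) => w u; lia.
Qed.

Lemma vX a i : a != 0 -> v (a ^+ i) = v a *+ i.
Proof.
move=> a0; elim: i => [|i IH]; first by rewrite expr0 v1.
by rewrite exprS vM ?expf_neq0 // IH mulrS.
Qed.

Lemma val_leN a z : val_le (- a) z = val_le a z.
Proof. by rewrite /val_le oppr_eq0 vN. Qed.

Lemma val_leE a z : a != 0 -> val_le a z = (v a <= z).
Proof. by rewrite /val_le => /negbTE->. Qed.

Lemma vD_neq a b : a != 0 -> b != 0 -> v a != v b ->
  a + b != 0 /\ v (a + b) = Num.max (v a) (v b).
Proof.
wlog ab : a b / v a < v b => [H|] a0 b0 n.
  move: n; rewrite neq_lt => /orP[] ab; first by apply: H; rewrite ?lt_eqF.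
  by rewrite addrC maxC; apply: H; rewrite ?lt_eqF.
have s0 : a + b != 0.
  by apply: contraTneq ab => /eqP; rewrite addr_eq0 => /eqP->; rewrite vN ltxx.
split=> //; apply/eqP; rewrite eq_le -val_leE // vD /=; last 2 first.
- by rewrite val_leE // le_max lexx.
- by rewrite val_leE // le_max lexx orbT.
rewrite max_r ?(ltW ab) // leNgt; apply/negP => h.
have : val_le (a + b - a) (Num.max (v (a + b)) (v a)).
  by apply: vD; rewrite ?val_leN val_leE // le_max lexx ?orbT.
by rewrite {1}[a + b]addrC addrK val_leE // le_max !leNgt h ab.
Qed.

Lemma vD_neq_le a b z : (b != 0 -> v a != v b) -> val_le (a + b) z -> val_le a z.
Proof.
have [->|a0] := eqVneq a 0; first by rewrite /val_le eqxx.
have [->|b0] := eqVneq b 0; first by rewrite addr0.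
move=> /(_ isT) h; have [s0 e] := vD_neq a0 b0 h.
by rewrite !val_leE // e ge_max => /andP[].
Qed.

Variable y : L.
Local Notation ev := (eval_map phi y).

(** The stages of the ramification of [y]: from [(n, 1)] down to [(1, n)], each
    key polynomial multiplies [s], and divides [d], by the same factor. *)
Definition level (d : nat) (s : nat) :=
  (forall h : {poly K}, h != 0 -> (size h <= s)%N -> ev h != 0 /\ (d %| v (ev h))%Z) /\
  (forall z, (d %| z)%Z -> exists h : {poly K}, [/\ h != 0, (size h <= s)%N & v (ev h) = z]).

Section Step.
Variables (d s E : nat) (M : {poly K}) (eta : int).
Hypotheses (lev : level d s) (Mm : M \is monic) (Ms : size M = s.+1)
  (evM : ev M != 0) (vMe : v (ev M) = eta)
  (dE : forall j, (0 < j < E)%N -> ~~ (d %| eta *+ j)%Z).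

(** The terms of the [M]-adic expansion have values in distinct classes modulo
    [d], so they cannot cancel each other. *)
Lemma expansion_values i (h : {poly K}) : (i <= E)%N -> h != 0 -> (size h <= i * s)%N ->
  ev h != 0 /\ exists2 j, (j < i)%N & (d %| v (ev h) - eta *+ j)%Z.
Proof.
elim: i h => [|i IH] h iE h0 hs.
  by move: hs; rewrite mul0n leqn0 size_poly_eq0 (negbTE h0).
have Xm : M ^+ i \is monic by rewrite monic_exp.
have Xs : size (M ^+ i) = (i * s).+1 by apply: size_monic_exp.
have X0 : ev (M ^+ i) != 0 by rewrite rmorphXn expf_neq0.
have vX' : v (ev (M ^+ i)) = eta *+ i by rewrite rmorphXn /= vX // vMe.
have he := Pdiv.RingMonic.rdivp_eq Xm h.
set q := Pdiv.Ring.rdivp _ _ in he; set r := Pdiv.Ring.rmodp _ _ in he.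
have rs : (size r <= i * s)%N.
  by rewrite -ltnS -Xs Pdiv.Ring.ltn_rmodp monic_neq0.
have qs : (size q <= s)%N.
  have [->|q0] := eqVneq q 0; first by rewrite size_poly0.
  have : (size (q * M ^+ i)%R <= i.+1 * s)%N.
    have -> : q * M ^+ i = h - r by rewrite {1}he addrK.
    apply: leq_trans (size_polyD _ _) _; rewrite geq_max hs size_polyN.
    by apply: leq_trans rs _; rewrite mulSn leq_addl.
  by rewrite size_Mmonic // Xs addnS /= mulSn leq_add2r.
have [q0|q0] := eqVneq q 0.
  have hr : h = r by rewrite he q0 mul0r add0r.
  have r0 : r != 0 by rewrite -hr.
  have [e0 [j ji jd]] := IH r (ltnW iE) r0 rs.
  by rewrite hr; split=> //; exists j => //; apply: leqW.
have [eq0 vq] := (proj1 lev) q q0 qs.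
have p0 : ev (q * M ^+ i) != 0 by rewrite rmorphM mulf_neq0.
have vp : v (ev (q * M ^+ i)) = v (ev q) + eta *+ i by rewrite rmorphM vM //= vX'.
have [r0|r0] := eqVneq r 0.
  rewrite he r0 addr0; split=> //; exists i => //.
  by rewrite vp addrK.
have [er0 [j ji jd]] := IH r (ltnW iE) r0 rs.
have ne : v (ev (q * M ^+ i)) != v (ev r).
  apply/eqP => e; have /dE/negP : (0 < i - j < E)%N.
    by rewrite subn_gt0 ji (leq_ltn_trans (leq_subr _ _) iE).
  apply; rewrite mulrnBr; last exact: ltnW.
  have -> : eta *+ i - eta *+ j = (v (ev r) - eta *+ j) - v (ev q).
    by rewrite -e vp; ring.
  by rewrite rpredB.
have [s0 e] := vD_neq p0 er0 ne; rewrite -rmorphD -he in s0 e.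
split=> //; rewrite e /Num.max; case: ifP => _; first by exists j => //; apply: leqW.
by exists i => //; rewrite vp addrK.
Qed.

(** The powers of the key polynomial [M] provide the classes modulo [d] that are
    multiples of [e]. *)
Lemma level_step (e : nat) : (0 < d)%N -> gcdz d eta = e -> d = (E * e)%N ->
  level e (E * s).
Proof.
move=> d0 ge de; split=> [h h0 hs|z].
  have [e0 [j ji jd]] := expansion_values (leqnn E) h0 hs; split=> //.
  rewrite -(subrK (eta *+ j) (v _)) rpredD ?rpredMn //; last by rewrite -ge dvdz_gcdr.
  by apply: dvdz_trans jd; rewrite -ge dvdz_gcdl.
move=> /(gcd_multiple_cover d0 ge de)[i iE dz].
have [b [b0 bs vb]] := (proj2 lev) _ dz.
exists (b * M ^+ i); have Xm : M ^+ i \is monic by rewrite monic_exp.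
split; first by rewrite mulf_neq0 // monic_neq0.
  rewrite size_Mmonic // (size_monic_exp _ _ Ms) // addnS /=.
  by apply: leq_trans (leq_mul iE (leqnn s)); rewrite mulSn leq_add2r.
rewrite rmorphM rmorphXn /= vM ?expf_neq0 ?(proj1 (proj1 lev _ b0 bs)) //.
by rewrite vb vX // vMe subrK.
Qed.

End Step.


Section ApproxValue.
Variables (d s E : nat) (eta : int) (Q Q2 : {poly K}).
Hypotheses (lev : level d s) (E1 : (1 < E)%N) (EK : E%:R != 0 :> K)
  (vE : v (phi E%:R) = 0)
  (dE : forall j, (0 < j < E)%N -> ~~ (d %| eta *+ j)%Z)
  (min : forall M : {poly K}, M \is monic -> size M = s.+1 ->
     ev M != 0 /\ eta <= v (ev M))
  (vQ2 : val_le (ev Q2) (eta *+ E))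
  (Qm : Q \is monic) (Qs : size Q = s.+1)
  (QE : (size (Q2 - Q ^+ E)%R <= E.-1 * s)%N).

(** In the expansion [Q2 = M ^+ E + c * M ^+ E.-1 + r], the value of the middle
    term is in a class modulo [d] that [r] avoids, so it is at most the bound
    [eta *+ E] on the values of [Q2] and [M ^+ E]; hence [c] has value at most [eta].
    Comparing leading coefficients, [c] is close to [E%:R *: (Q - M)]. *)
Lemma approximate_root_correction M : M \is monic -> size M = s.+1 ->
    v (ev M) = eta -> Q != M ->
  exists c : {poly K}, [/\ (size c <= s)%N, val_le (ev c) eta &
    (size (c - E%:R *: (Q - M))%R < size (Q - M)%R)%N].
Proof.
move=> Mm Ms vMe QM; set b := Q - M.
have b0 : b != 0 by rewrite subr_eq0.
have bs : (size b <= s)%N by apply: size_sub_monic.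
have E0 : (0 < E)%N by apply: ltnW.
have Xm : M ^+ E.-1 \is monic by rewrite monic_exp.
have Xs : size (M ^+ E.-1) = (E.-1 * s).+1 by apply: size_monic_exp.
have [S [eS Ss Sc]] := sub_expr_monic E0 Qm Mm Qs Ms; rewrite -/b in eS.
have he := Pdiv.RingMonic.rdivp_eq Xm (Q2 - M ^+ E).
set c := Pdiv.Ring.rdivp _ _ in he; set r := Pdiv.Ring.rmodp _ _ in he.
have rs : (size r <= E.-1 * s)%N.
  by rewrite -ltnS -Xs Pdiv.Ring.ltn_rmodp monic_neq0.
have cb : (size (c - E%:R *: b)%R < size b)%N.
  have [->|x0] := eqVneq (c - E%:R *: b) 0; first by rewrite size_poly0 size_poly_gt0.
  have xe : (c - E%:R *: b) * M ^+ E.-1 =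
      b * (S - E%:R *: M ^+ E.-1) + (Q2 - Q ^+ E - r).
    have cX : c * M ^+ E.-1 = Q2 - M ^+ E - r by rewrite he addrK.
    rewrite mulrBl cX -scalerAl mulrBr -eS -scalerAr.
    by move: (_ *: _) => w; ring.
  have Ds : (size (S - E%:R *: M ^+ E.-1)%R <= E.-1 * s)%N.
    apply/leq_sizeP => j; rewrite leq_eqVlt => /orP[/eqP<-|sj].
      by rewrite coefB coefZ (monic_coef Xm Xs) Sc mulr1 subrr.
    by rewrite coefB coefZ !nth_default ?mulr0 ?subrr ?Xs // (leq_trans Ss).
  have : (size ((c - E%:R *: b) * M ^+ E.-1)%R <= size b + (E.-1 * s) - 1)%N.
    rewrite xe; apply: leq_trans (size_polyD _ _) _; rewrite geq_max.
    have b1 : (0 < size b)%N by rewrite size_poly_gt0.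
    apply/andP; split.
      apply: leq_trans (size_polyMleq _ _) _; rewrite -subn1.
      by rewrite leq_sub2r // leq_add2l.
    rewrite -addnBAC //; apply: leq_trans (leq_addl _ _).
    by apply: leq_trans (size_polyD _ _) _; rewrite geq_max QE size_polyN.
  rewrite size_Mmonic // Xs addnS /=.
  by rewrite -addnBAC ?size_poly_gt0 // leq_add2r subn1 -ltnS prednK // size_poly_gt0.
have cs : (size c <= s)%N.
  rewrite -[c](subrK (E%:R *: b)); apply: leq_trans (size_polyD _ _) _.
  rewrite geq_max (leq_trans (ltnW cb) bs) /=.
  exact: leq_trans (size_scale_leq _ _) bs.
exists c; split=> //.
have evM := proj1 (min Mm Ms).
have [->|c0] := eqVneq c 0; first by rewrite rmorph0 /val_le eqxx.
have [ec0 dc] := proj1 lev c c0 cs.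
have X0 : ev (M ^+ E.-1) != 0 by rewrite rmorphXn expf_neq0.
have vcX : v (ev (c * M ^+ E.-1)) = v (ev c) + eta *+ E.-1.
  by rewrite rmorphM vM // rmorphXn /= vX // vMe.
have : val_le (ev (c * M ^+ E.-1)) (eta *+ E).
  apply: (@vD_neq_le _ (ev r)) => [er0|].
    have r0 : r != 0 by apply: contraNneq er0 => ->; rewrite rmorph0.
    have [_ [j ji jd]] := expansion_values lev Mm Ms evM vMe dE (leq_pred E) r0 rs.
    apply/eqP => e; have /dE/negP : (0 < E.-1 - j < E)%N.
      by rewrite subn_gt0 ji (leq_ltn_trans (leq_subr _ _)) // prednK.
    apply; rewrite mulrnBr; last exact: ltnW.
    have -> : eta *+ E.-1 - eta *+ j = (v (ev r) - eta *+ j) - v (ev c).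
      by rewrite -e vcX; ring.
    by rewrite rpredB.
  rewrite -rmorphD /= -he rmorphB; apply: vD => //.
  by rewrite val_leN rmorphXn /val_le /= vX // vMe lexx orbT.
rewrite val_leE; last by rewrite rmorphM mulf_neq0.
rewrite vcX -{2}(prednK E0) mulrS lerD2r => h.
by rewrite val_leE.
Qed.

Lemma val_le_scale c z : val_le (ev c) z -> val_le (ev (E%:R^-1 *: c)) z.
Proof.
have e : ev (E%:R^-1 *: c) = phi E%:R^-1 * ev c by rewrite eval_mapZ.
rewrite e; have [->|c0] := eqVneq (ev c) 0; first by rewrite mulr0.
have E0 : phi E%:R^-1 != 0 by rewrite fmorph_eq0 invr_eq0.
have E0' : phi E%:R != 0 by rewrite fmorph_eq0.
rewrite !val_leE ?mulf_neq0 // vM //.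
have := vM E0 E0'; rewrite -rmorphM mulVf // rmorph1 v1 vE addr0 => <-.
by rewrite add0r.
Qed.

(** Adding [c / E] to [M] does not raise its value, which is minimal, and lowers
    the degree of [Q - M]. Once [M] has become [Q], the value of [Q] is known. *)
Lemma approximate_root_value M : M \is monic -> size M = s.+1 ->
  v (ev M) = eta -> v (ev Q) = eta.
Proof.
have [m] := ubnP (size (Q - M)%R); elim: m M => // m IH M ltm Mm Ms vMe.
have [<-//|QM] := eqVneq M Q; rewrite eq_sym in QM.
have [c [cs vc cb]] := approximate_root_correction Mm Ms vMe QM.
have es : (size (E%:R^-1 *: c) <= s)%N by apply: leq_trans (size_scale_leq _ _) cs.
have [M'm M's] := monicD_small Mm Ms es.
apply: (IH (M + E%:R^-1 *: c)) => //; last first.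
  apply/eqP; rewrite eq_le; have [e0 ->] := min M'm M's.
  rewrite andbT -val_leE //.
  have evM := proj1 (min Mm Ms).
  rewrite rmorphD; apply: vD; first by rewrite val_leE // vMe.
  by apply: val_le_scale.
have -> : Q - (M + E%:R^-1 *: c) = - (E%:R^-1 *: (c - E%:R *: (Q - M))).
  by rewrite scalerBr scalerA mulVf // scale1r opprB opprD addrA.
rewrite size_polyN size_scale ?invr_eq0 //; exact: leq_trans cb _.
Qed.
End ApproxValue.


Section Tower.
Variables (R : comNzRingType) (io : {rmorphism R -> K}) (n : nat) (P : {poly R}).
Hypotheses (io_inj : injective io) (n0 : (0 < n)%N)
  (natV : forall m, (0 < m)%N -> exists u : R, u * m%:R = 1)
  (vnat : forall m, (0 < m)%N -> v (phi m%:R) = 0)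
  (vres : forall a b : L, a != 0 -> b != 0 -> v a = v b ->
     exists c : K, a - phi c * b = 0 \/ v (a - phi c * b) < v a)
  (evinj : forall h : {poly K}, h != 0 -> (size h <= n)%N -> ev h != 0)
  (Pm : P \is monic) (Ps : size P = n.+1) (evP : ev (map_poly io P) = 0)
  (vpos : forall h : {poly R}, ev (map_poly io h) != 0 ->
     0 <= v (ev (map_poly io h)))
  (vbound : forall s, (s < n)%N -> exists B : int, forall M : {poly K},
     M \is monic -> size M = s.+1 -> B <= v (ev M)).
Let evR (h : {poly R}) : L := ev (map_poly io h).

Lemma size_map_io h : size (map_poly io h) = size h.
Proof. by rewrite size_map_inj_poly ?rmorph0. Qed.

Lemma ev_monic_neq0 (M : {poly K}) s : (s < n)%N -> M \is monic ->
  size M = s.+1 -> ev M != 0.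
Proof. by move=> sn Mm Ms; rewrite evinj ?monic_neq0 // Ms. Qed.

Lemma min_monic s : (s < n)%N -> exists M : {poly K},
  [/\ M \is monic, size M = s.+1 &
   forall M' : {poly K}, M' \is monic -> size M' = s.+1 -> v (ev M) <= v (ev M')].
Proof.
move=> sn; have [B HB] := vbound sn.
pose p (m : nat) := `[< exists M : {poly K},
  [/\ M \is monic, size M = s.+1 & v (ev M) = B + m%:Z] >].
have expos (M : {poly K}) : M \is monic -> size M = s.+1 ->
    p `|v (ev M) - B|%N.
  move=> Mm Ms; apply/asboolP; exists M; split=> //.
  by rewrite gez0_abs ?subr_ge0 ?HB //; ring.
have exp : exists m, p m.
  by exists `|v (ev 'X^s) - B|%N; apply: expos; rewrite ?monicXn ?size_polyXn.
case: (ex_minnP exp) => m /asboolP[M [Mm Ms vMe]] mmin.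
exists M; split=> // M' M'm M's; have := mmin _ (expos M' M'm M's).
have := HB _ M'm M's; rewrite vMe.
by move: (v (ev M')) => w; lia.
Qed.

(** A value divisible by [d] is that of a polynomial of smaller degree, which
    would allow lowering the value of [M] by subtraction. *)
Lemma min_monic_value d s (M : {poly K}) : (s < n)%N -> level d s ->
    M \is monic -> size M = s.+1 ->
    (forall M' : {poly K}, M' \is monic -> size M' = s.+1 -> v (ev M) <= v (ev M')) ->
  ~~ (d %| v (ev M))%Z.
Proof.
move=> sn lev Mm Ms min; apply/negP => /(proj2 lev)[b [b0 bs vb]].
have M0 := ev_monic_neq0 sn Mm Ms; have eb0 := proj1 (proj1 lev b b0 bs).
have [c hc] := vres M0 eb0 (esym vb).
have bs' : (size (- (c *: b))%R <= s)%N.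
  by rewrite size_polyN; apply: leq_trans (size_scale_leq _ _) bs.
have [M'm M's] := monicD_small Mm Ms bs'.
have e : ev (M - c *: b) = ev M - phi c * ev b.
  by rewrite rmorphB /=; congr (_ - _); rewrite eval_mapZ.
case: hc; rewrite -e => h; first by have := ev_monic_neq0 sn M'm M's; rewrite h eqxx.
by have := min _ M'm M's; rewrite leNgt h.
Qed.

(** [Q] is the key polynomial of degree [s], and [N] the product of suitable
    powers of the key polynomials of degree at least [s], in such a way that the
    class modulo [d] of its value is avoided in smaller degrees. Minimal monic
    polynomials over [K] lead to the next stage [e < d]; what the induction
    returns has coefficients in [R], and an approximate root brings such
    coefficients back to the stage [d]. *)
Lemma key_tower d s : (0 < d)%N -> n = (d * s)%N -> level d s ->
  exists Q N : {poly R},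
   [/\ Q \is monic /\ size Q = s.+1, N \is monic /\ size N = (n - s).+1,
       forall M : {poly K}, M \is monic -> size M = s.+1 ->
         val_le (evR Q) (v (ev M)),
       forall r : {poly K}, r != 0 -> (size r <= n - s)%N ->
         ~~ (d %| v (ev r) - v (evR N))%Z &
       (1 < d)%N -> v (evR Q) <= v (evR N)].
Proof.
have [m] := ubnP d; elim: m d s => // m IH d s dm d0 nds lev.
have [d1|d_neq1] := eqVneq d 1%N.
  have {}nds : n = s by rewrite nds d1 mul1n.
  exists P, 1; split=> //.
  - by rewrite -nds.
  - by rewrite monic1 size_poly1 nds subnn.
  - by move=> M _ _; rewrite /evR evP /val_le eqxx.
  - by move=> r r0; rewrite nds subnn leqn0 size_poly_eq0 (negbTE r0).
  - by rewrite d1.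
have d1 : (1 < d)%N by rewrite ltn_neqAle eq_sym d_neq1.
have s0 : (0 < s)%N by move: n0; rewrite nds muln_gt0 => /andP[].
have sn : (s < n)%N by rewrite nds -{1}[s]mul1n ltn_pmul2r.
have [Q1 [Q1m Q1s Q1min]] := min_monic sn.
have ndeta := min_monic_value sn lev Q1m Q1s Q1min.
set eta := v (ev Q1) in Q1min ndeta.
(* the values at the next stage are the multiples of e *)
have [e ge] : exists e : nat, gcdz d eta = e by eexists; reflexivity.
have [E de] : exists E, d = (E * e)%N.
  by apply/dvdnP; rewrite -[e]/`|e%:Z|%N -ge; apply: dvdz_gcdl.
have e0 : (0 < e)%N by move: d0; rewrite de muln_gt0 => /andP[].
have E1 : (1 < E)%N.
  case: (E) de => [|[|//]] de; first by move: d0; rewrite de.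
  by case/negP: ndeta; rewrite de mul1n -ge dvdz_gcdr.
have ed : (e < d)%N by rewrite de -{1}[e]mul1n ltn_pmul2r.
have dE := gcd_multiple_notin d0 ge de.
have Q10 := ev_monic_neq0 sn Q1m Q1s.
have lev' := level_step lev Q1m Q1s Q10 erefl dE d0 ge de.
have nE : n = (e * (E * s))%N by rewrite nds de; ring.
have [||||Q2 [N [[Q2m Q2s] [Nm Ns] Q2min Nval _]]] := IH e (E * s)%N => //.
  exact: leq_trans ed _.
have E0 : (0 < E)%N by apply: ltnW.
have [u uE] := natV E0.
(* Q2 has coefficients in R, hence so does its approximate root *)
have [Q [Qm Qs QE]] := approximate_root E0 uE Q2m Q2s.
have vQ : v (evR Q) = eta.
  apply: (@approximate_root_value d s E eta _ (map_poly io Q2) lev E1 _ _ dE _ _ _ _ _ Q1 Q1m Q1s erefl) => //.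
  - by apply/eqP => EK; have := congr1 io uE; rewrite rmorphM rmorph_nat EK mulr0 rmorph1 => /esym/eqP; rewrite oner_eq0.
  - exact: vnat.
  - by move=> M Mm Ms; split; [apply: ev_monic_neq0 sn Mm Ms | apply: Q1min].
  - have := Q2min (Q1 ^+ E); rewrite monic_exp // (size_monic_exp _ Q1m Q1s).
    by move=> /(_ isT erefl); rewrite rmorphXn /= vX.
  - exact: monic_map.
  - by rewrite size_map_io.
  - by rewrite -rmorphXn -rmorphB /= size_map_io.
have Q0 : evR Q != 0 by rewrite (ev_monic_neq0 sn) ?monic_map // size_map_io.
have Nmap : map_poly io N \is monic by apply: monic_map.
have Nn : (n - E * s < n)%N by rewrite ltn_subrL n0 muln_gt0 E0 s0.
have N0 : evR N != 0 by rewrite (ev_monic_neq0 Nn) // size_map_io.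
have evQN i : evR (Q ^+ i * N) = evR Q ^+ i * evR N.
  by rewrite /evR !rmorphM !rmorphXn.
have vQN i : v (evR (Q ^+ i * N)) = eta *+ i + v (evR N).
  by rewrite evQN vM ?expf_neq0 // vX // vQ.
have EsE : (E * s = s + E.-1 * s)%N by rewrite -mulSn prednK.
have hEs : (E * s <= n)%N by rewrite nE leq_pmull.
have e_eta : (e %| eta)%Z by rewrite -ge dvdz_gcdr.
have e_d : (e %| d%:Z)%Z by rewrite -ge dvdz_gcdl.
exists Q, (Q ^+ E.-1 * N); split=> //.
- rewrite monicMl ?monic_exp // size_monicM ?monic_exp ?monic_neq0 //.
  rewrite (size_monic_exp _ Qm Qs) Ns addnS /=; split=> //.
  by move: hEs; rewrite EsE; move: (E.-1 * s)%N n => x y0; clear; lia.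
- by move=> M Mm Ms; rewrite val_leE // vQ; apply: Q1min.
- move=> r r0 rs; rewrite vQN.
  have he := Pdiv.RingMonic.rdivp_eq Nmap r.
  set q := Pdiv.Ring.rdivp _ _ in he; set r' := Pdiv.Ring.rmodp _ _ in he.
  have r's : (size r' <= n - E * s)%N.
    by rewrite -ltnS -Ns -size_map_io Pdiv.Ring.ltn_rmodp monic_neq0.
  have qs : (size q <= E.-1 * s)%N.
    have [->|q0] := eqVneq q 0; first by rewrite size_poly0.
    have : (size (q * map_poly io N)%R <= n - s)%N.
      have -> : q * map_poly io N = r - r' by rewrite {1}he addrK.
      apply: leq_trans (size_polyD _ _) _; rewrite geq_max rs size_polyN.
      apply: leq_trans r's _; apply: leq_sub2l; exact: leq_pmull.
    rewrite size_Mmonic // size_map_io Ns addnS /=.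
    by move: hEs; rewrite EsE; move: (E.-1 * s)%N n (size q) => x y0 z; clear; lia.
  have shift z : (d %| z - (eta *+ E.-1 + v (evR N)))%Z -> (e %| z - v (evR N))%Z.
    move=> /(dvdz_trans e_d) h.
    have -> : z - v (evR N) = z - (eta *+ E.-1 + v (evR N)) + eta *+ E.-1 by ring.
    by rewrite rpredD ?rpredMn.
  have [q0|q0] := eqVneq q 0.
    have r'e : r = r' by rewrite {1}he q0 mul0r add0r.
    by apply/negP => /shift; apply/negP; rewrite r'e Nval // -r'e.
  have Qmm : map_poly io Q \is monic by apply: monic_map.
  have Qms : size (map_poly io Q) = s.+1 by rewrite size_map_io.
  have [eq0 [j jE jd]] := expansion_values lev Qmm Qms Q0 vQ dE (leq_pred E) q0 qs.
  have qN0 : ev (q * map_poly io N) != 0 by rewrite rmorphM mulf_neq0.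
  have vqN : v (ev (q * map_poly io N)) = v (ev q) + v (evR N).
    by rewrite rmorphM vM.
  (* the expansion of q lacks the power Q ^+ E.-1, which distinguishes N *)
  have topne : ~~ (d %| v (ev (q * map_poly io N)) - (eta *+ E.-1 + v (evR N)))%Z.
    apply/negP => h; have /dE/negP : (0 < E.-1 - j < E)%N.
      by rewrite subn_gt0 jE (leq_ltn_trans (leq_subr _ _)) // prednK.
    apply; rewrite mulrnBr; last exact: ltnW.
    have -> : eta *+ E.-1 - eta *+ j = (v (ev q) - eta *+ j) -
        (v (ev (q * map_poly io N)) - (eta *+ E.-1 + v (evR N))).
      by rewrite vqN; ring.
    by rewrite rpredB.
  have [r'0|r'0] := eqVneq r' 0; first by rewrite he r'0 addr0.
  have er'0 : ev r' != 0.
    by rewrite evinj // (leq_trans r's) // leq_subr.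
  have r'ne := Nval _ r'0 r's.
  have ne : v (ev (q * map_poly io N)) != v (ev r').
    apply: contraNneq r'ne => <-; rewrite vqN addrK.
    rewrite -(subrK (eta *+ j) (v _)) rpredD ?rpredMn //.
    exact: dvdz_trans jd.
  have [_ e'] := vD_neq qN0 er'0 ne; rewrite -rmorphD -he in e'.
  rewrite e' /Num.max; case: ifP => _ //.
  by apply/negP => /shift; apply/negP.
- move=> _; rewrite vQN vQ.
  have := vpos Q0; have := vpos N0; rewrite -!/(evR _) vQ.
  case: (E) E1 => [|[|E']] //= _ vN0 eta0; rewrite mulrS -addrA lerDl.
  by rewrite addr_ge0 // mulrn_wge0.
Qed.
End Tower.


Lemma level_base (n : nat) :
    (forall c : K, c != 0 -> (n %| v (phi c))%Z) ->
    (forall z, (n %| z)%Z -> exists2 c : K, c != 0 & v (phi c) = z) ->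
  level n 1.
Proof.
move=> vK vKs; split=> [h h0|z /vKs[c c0 <-]].
  move=> /size1_polyC hE; move: h0; rewrite hE polyC_eq0 => c0.
  by rewrite eval_mapC fmorph_eq0 c0 vK.
by exists c%:P; rewrite polyC_eq0 c0 eval_mapC size_polyC c0.
Qed.

(** In this section [h0] has value [n - 1], a class modulo [n] that does not occur
    in degrees at most [n - 2]: its leading term carries its value. *)
Section Reduction.
Variables (R : comNzRingType) (io : {rmorphism R -> K}) (n : nat) (P h0 : {poly R}).
Hypotheses (io_inj : injective io) (n1 : (1 < n)%N)
  (natV : forall m, (0 < m)%N -> exists u : R, u * m%:R = 1)
  (vnat : forall m, (0 < m)%N -> v (phi m%:R) = 0)
  (vres : forall a b : L, a != 0 -> b != 0 -> v a = v b ->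
     exists c : K, a - phi c * b = 0 \/ v (a - phi c * b) < v a)
  (vK : forall c : K, c != 0 -> (n %| v (phi c))%Z)
  (vK_surj : forall z, (n %| z)%Z -> exists2 c : K, c != 0 & v (phi c) = z)
  (evinj : forall h : {poly K}, h != 0 -> (size h <= n)%N -> ev h != 0)
  (Pm : P \is monic) (Ps : size P = n.+1) (evP : ev (map_poly io P) = 0)
  (vpos : forall h : {poly R}, ev (map_poly io h) != 0 ->
     0 <= v (ev (map_poly io h)))
  (h0s : (size h0 <= n)%N) (h00 : ev (map_poly io h0) != 0)
  (vh0 : v (ev (map_poly io h0)) = n%:Z - 1)
  (gap : forall h : {poly K}, h != 0 -> (size h <= n.-1)%N ->
     ~~ (n %| v (ev h) + 1)%Z).

Let h := map_poly io h0.
Let a := h`_n.-1.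

Lemma top_coef_split (T : {poly K}) : T \is monic -> size T = n ->
  exists2 r, h = a *: T + r & (size r <= n.-1)%N.
Proof.
move=> Tm Ts; exists (h - a *: T); first by rewrite addrC subrK.
have n0 : (0 < n)%N by apply: ltnW.
have Ts' : size T = n.-1.+1 by rewrite prednK.
apply/leq_sizeP => j; rewrite leq_eqVlt => /orP[/eqP<-|sj].
  by rewrite coefB coefZ (monic_coef Tm Ts') mulr1 subrr.
rewrite prednK // in sj.
rewrite coefB coefZ !nth_default ?mulr0 ?subrr ?Ts //.
by apply: leq_trans sj; rewrite size_map_io.
Qed.

Lemma top_coef_neq0 : a != 0.
Proof.
apply/eqP => a0.
have [|r] := @top_coef_split 'X^(n.-1) (monicXn _ _); first by rewrite size_polyXn prednK // ltnW.
rewrite a0 scale0r add0r => hr rs.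
have /negP : ~~ (n %| v (ev h) + 1)%Z.
  by rewrite gap ?hr // -hr; apply: contraNneq h00 => h0e; rewrite -/h h0e rmorph0.
by apply; rewrite vh0 subrK.
Qed.

Lemma monic_value_lower_bound (T : {poly K}) : T \is monic -> size T = n ->
  n%:Z - 1 <= v (phi a) + v (ev T).
Proof.
move=> Tm Ts; have [r hr rs] := top_coef_split Tm Ts.
have T0 : ev T != 0 by rewrite evinj ?monic_neq0 // Ts.
have a0 : phi a != 0 by rewrite fmorph_eq0 top_coef_neq0.
have eaT : ev (a *: T) = phi a * ev T by rewrite eval_mapZ.
rewrite -vM // -eaT -vh0.
have [r0|r0] := eqVneq r 0; first by rewrite -/h {1}hr r0 addr0.
have er0 : - ev r != 0 by rewrite oppr_eq0 evinj // (leq_trans rs) // leq_pred.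
have ne : v (ev h) != v (- ev r).
  rewrite vN; apply: contraNneq (gap r0 rs) => <-.
  by rewrite vh0 subrK.
have [_] := vD_neq h00 er0 ne.
have -> : ev (map_poly io h0) - ev r = ev (a *: T).
  by rewrite -rmorphB /= -/h hr addrK.
by move=> ->; rewrite le_max lexx.
Qed.

Lemma monic_value_bounded s : (s < n)%N -> exists B : int,
  forall M : {poly K}, M \is monic -> size M = s.+1 -> B <= v (ev M).
Proof.
move=> sn; exists (n%:Z - 1 - v (phi a) - v (y ^+ (n.-1 - s))) => M Mm Ms.
have y0 : y != 0.
  have : ev 'X != 0 by rewrite evinj ?polyX_eq0 // size_polyX.
  by rewrite eval_mapX.
have := @monic_value_lower_bound ('X^(n.-1 - s) * M).
rewrite monicMl ?monicXn // size_monicM ?monicXn ?monic_neq0 // size_polyXn Ms.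
have -> : ((n.-1 - s).+1 + s.+1).-1 = n by clear -sn; lia.
move=> /(_ Mm erefl).
have -> : ev ('X^(n.-1 - s) * M) = y ^+ (n.-1 - s) * ev M.
  by rewrite rmorphM /= eval_mapXn.
rewrite vM ?expf_neq0 ?(ev_monic_neq0 evinj sn Mm) //.
move: (v _) (v _) (v (ev M)) => b c d; clear; lia.
Qed.

(** At the stage [(n, 1)] the key polynomial is [y + b] and [N] is monic of degree
    [n - 1]. The value of [N] is at least that of [y + b], because the other
    factors have nonnegative values, and at most that of [h0]. *)
Lemma degree_reduction : exists b : R, v (y + phi (io b)) <= n%:Z - 1.
Proof.
have n0 : (0 < n)%N by apply: ltnW.
have [Q [N [[Qm Qs] [Nm Ns] _ Nval QN]]] := @key_tower R io n P io_inj n0 natV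
   vnat vres evinj Pm Ps evP vpos monic_value_bounded n 1 n0 (esym (muln1 n))
   (level_base vK vK_surj).
have {}QN := QN n1.
have QE : map_poly io Q = 'X + (io Q`_0)%:P.
  apply/polyP => -[|[|i]]; rewrite coef_map coefD coefX coefC /= ?add0r ?addr0 //.
    by rewrite (monic_coef Qm Qs) rmorph1.
  by rewrite nth_default ?rmorph0 // Qs.
exists Q`_0.
have <- : ev (map_poly io Q) = y + phi (io Q`_0).
  by rewrite QE rmorphD /= eval_mapC eval_mapX.
apply: le_trans QN _.
have Nm' : map_poly io N \is monic by apply: monic_map.
have Ns' : size (map_poly io N) = n by rewrite size_map_io // Ns subn1 prednK.
have [r hr rs] := top_coef_split Nm' Ns'.
have N0 : ev (map_poly io N) != 0 by rewrite evinj ?monic_neq0 // Ns'.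
have a0 : phi a != 0 by rewrite fmorph_eq0 top_coef_neq0.
have vaN : v (ev (a *: map_poly io N)) = v (phi a) + v (ev (map_poly io N)).
  by rewrite -vM //; congr v; rewrite eval_mapZ.
have aN0 : ev (a *: map_poly io N) != 0.
  by rewrite eval_mapZ mulf_neq0.
have vapos : 0 <= v (phi a).
  have -> : phi a = ev (map_poly io (h0`_n.-1)%:P).
    by rewrite map_polyC eval_mapC /a /h coef_map.
  by apply: vpos; rewrite map_polyC eval_mapC -coef_map.
suff : v (ev (a *: map_poly io N)) <= n%:Z - 1.
  by rewrite vaN; apply: le_trans; rewrite lerDr.
have [r0|r0] := eqVneq r 0; first by rewrite -vh0 -/h hr r0 addr0.
have er0 : ev r != 0 by rewrite evinj // (leq_trans rs) // leq_pred.
have ne : v (ev (a *: map_poly io N)) != v (ev r).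
  apply/eqP => e; have := Nval r r0; rewrite subn1 => /(_ rs)/negP; apply.
  by rewrite -e vaN addrK vK // top_coef_neq0.
have [_] := vD_neq aN0 er0 ne; rewrite -rmorphD -hr vh0 => ->.
by rewrite le_max lexx.
Qed.
End Reduction.

End Valuation.

(** * The last coordinate as a generator of the dual *)
Section TopForm.
Variables (R : comNzRingType) (n : nat) (P : {poly R}).
Hypotheses (n0 : (0 < n)%N) (Pm : P \is monic) (Ps : size P = n.+1).
Implicit Types (h u q : {poly R}).

Definition top_form h : R := (Pdiv.Ring.rmodp h P)`_n.-1.

Lemma top_form_small h : (size h <= n)%N -> top_form h = h`_n.-1.
Proof. by move=> hs; rewrite /top_form Pdiv.Ring.rmodp_small // Ps. Qed.

Lemma top_formD h1 h2 : top_form (h1 + h2) = top_form h1 + top_form h2.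
Proof. by rewrite /top_form Pdiv.RingMonic.rmodpD // coefD. Qed.

Lemma top_formZ c h : top_form (c *: h) = c * top_form h.
Proof. by rewrite /top_form Pdiv.RingMonic.rmodpZ // coefZ. Qed.

Lemma top_formMP q : top_form (q * P) = 0.
Proof. by rewrite /top_form Pdiv.RingMonic.rmodp_mull // coef0. Qed.

Lemma top_form_sum (I : Type) (r : seq I) (Q : pred I) (G : I -> {poly R}) :
  top_form (\sum_(i <- r | Q i) G i) = \sum_(i <- r | Q i) top_form (G i).
Proof.
apply: (big_morph _ top_formD); rewrite /top_form Pdiv.Ring.rmod0p; exact: coef0.
Qed.

(** The quotients of [P] by the powers of the variable (Horner's polynomials) form
    the basis dual to the powers of the variable. *)
Lemma top_form_dual i j : (i < n)%N -> (j < n)%N ->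
  top_form (drop_poly i.+1 P * 'X^j) = (i == j)%:R.
Proof.
move=> ilt jlt; case: (leqP j i) => [ji|ij].
  rewrite top_form_small; last first.
    apply: leq_trans (size_polyMleq _ _) _.
    by rewrite size_polyXn size_drop_poly Ps; move: n0; lia.
  rewrite coefMXn coef_drop_poly; have -> : (n.-1 < j)%N = false by lia.
  have -> : (n.-1 - j + i.+1 = n + (i - j))%N by lia.
  move: ji; rewrite leq_eqVlt => /orP[/eqP->|ji].
    by rewrite eqxx subnn addn0 (monic_coef Pm Ps).
  rewrite nth_default; last by rewrite Ps; lia.
  by rewrite (gtn_eqF ji).
have e : drop_poly i.+1 P * 'X^j = 'X^(j - i.+1) * P + - ('X^(j - i.+1) * take_poly i.+1 P).
  rewrite -mulrBr -{2}(poly_take_drop i.+1 P) [take_poly _ _ + _]addrC addrK.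
  by rewrite mulrCA -exprD subnK.
rewrite e top_formD top_formMP add0r top_form_small; last first.
  rewrite size_polyN; apply: leq_trans (size_polyMleq _ _) _; rewrite size_polyXn.
  have := size_take_poly i.+1 P; move: (size (take_poly _ _)) => z zi.
  by move: ij jlt zi; clear; lia.
rewrite coefN coefXnM; case: ifP => [_|/negbT]; first by rewrite oppr0 (ltn_eqF ij).
move=> h; rewrite coef_take_poly; have -> : (n.-1 - (j - i.+1) < i.+1)%N = false by lia.
by rewrite oppr0 (ltn_eqF ij).
Qed.

Lemma top_form_nondegenerate u :
  (forall h, top_form (u * h) = 0) -> exists q, u = q * P.
Proof.
move=> u0; exists (Pdiv.Ring.rdivp u P).
have he := Pdiv.RingMonic.rdivp_eq Pm u.
set q := Pdiv.Ring.rdivp _ _ in he *; set r := Pdiv.Ring.rmodp _ _ in he.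
suff r0 : r = 0 by rewrite {1}he r0 addr0.
have rs : (size r <= n)%N.
  by rewrite -ltnS -Ps Pdiv.Ring.ltn_rmodp monic_neq0.
apply/polyP => i; rewrite coef0; case: (leqP n i) => [ni|ni].
  by rewrite nth_default // (leq_trans rs).
have := u0 (drop_poly i.+1 P); rewrite he mulrDl mulrAC top_formD top_formMP add0r.
rewrite -[X in X * _](coefK r) poly_def mulr_suml top_form_sum => e0; rewrite -[RHS]e0.
have isz (j : 'I_(size r)) : (j < n)%N by apply: leq_trans rs.
rewrite (eq_bigr (fun j : 'I_(size r) => r`_j * (i == j)%:R)); last first.
  by move=> j _; rewrite -scalerAl top_formZ mulrC [_ * drop_poly _ _]mulrC mulrC top_form_dual.
case: (leqP (size r) i) => [si|si].
  rewrite nth_default // big1 // => j _.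
  have /negbTE-> : i != j by rewrite neq_ltn (leq_trans (ltn_ord j) si) orbT.
  by rewrite mulr0.
rewrite (bigD1 (Ordinal si)) //= eqxx mulr1 big1 ?addr0 // => j ji.
have /negbTE-> : i != j by apply: contra ji => /eqP e; apply/eqP/val_inj.
by rewrite mulr0.
Qed.

Lemma top_form_representation (l : {poly R} -> R) :
    (forall h1 h2, l (h1 + h2) = l h1 + l h2) -> (forall c h, l (c *: h) = c * l h) ->
    (forall q, l (q * P) = 0) ->
  exists u, forall h, l h = top_form (u * h).
Proof.
move=> lD lZ lP; exists (\sum_(i < n) l 'X^i *: drop_poly i.+1 P) => h.
set u := \sum_(i < n) _.
have he := Pdiv.RingMonic.rdivp_eq Pm h.
set q := Pdiv.Ring.rdivp _ _ in he *; set r := Pdiv.Ring.rmodp _ _ in he.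
have rs : (size r <= n)%N.
  by rewrite -ltnS -Ps Pdiv.Ring.ltn_rmodp monic_neq0.
have l0 : l 0 = 0 by rewrite -(scale0r 0) lZ mul0r.
have lsum (I : Type) (s : seq I) (G : I -> {poly R}) :
  l (\sum_(i <- s) G i) = \sum_(i <- s) l (G i) by apply: (big_morph l lD l0).
rewrite he lD lP mulrDr mulrA top_formD top_formMP !add0r.
rewrite -[r]coefK poly_def lsum mulr_sumr top_form_sum; apply: eq_bigr => j _.
have jn : (j < n)%N by apply: leq_trans rs.
rewrite lZ -scalerAr top_formZ; congr (_ * _).
rewrite mulr_suml top_form_sum (bigD1 (Ordinal jn)) //= -scalerAl top_formZ.
rewrite top_form_dual // eqxx mulr1 big1 ?addr0 // => i ij.
rewrite -scalerAl top_formZ top_form_dual //.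
have /negbTE-> : i != j :> nat by apply: contra ij => /eqP e; apply/eqP/val_inj.
by rewrite mulr0.
Qed.
End TopForm.

Section TwoPresentations.
Variables (R A : comNzRingType) (sigma : {rmorphism R -> A}) (n : nat).
Hypothesis (n0 : (0 < n)%N).

(** [A] is the [R]-algebra [R[y]/(P)]. *)
Definition presentation (y : A) (P : {poly R}) :=
  [/\ P \is monic, size P = n.+1, forall a, exists h, eval_map sigma y h = a &
      forall h, eval_map sigma y h = 0 <-> exists q, h = q * P].

Lemma presentation_small y P a : presentation y P ->
  exists2 h : {poly R}, (size h <= n)%N & eval_map sigma y h = a.
Proof.
move=> [Pm Ps surj ker]; have [h <-] := surj a.
exists (Pdiv.Ring.rmodp h P).
  by rewrite -ltnS -Ps Pdiv.Ring.ltn_rmodp monic_neq0.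
rewrite [in RHS](Pdiv.RingMonic.rdivp_eq Pm h) rmorphD /=.
have -> : eval_map sigma y (Pdiv.Ring.rdivp h P * P) = 0 by apply/ker; eexists.
by rewrite add0r.
Qed.

Lemma presentation_intro y P : P \is monic -> size P = n.+1 -> eval_map sigma y P = 0 ->
    (forall a, exists h, eval_map sigma y h = a) ->
    (forall h : {poly R}, (size h <= n)%N -> eval_map sigma y h = 0 -> h = 0) ->
  presentation y P.
Proof.
move=> Pm Ps P0 surj free; split=> // h; split=> [h0|[q ->]]; last first.
  by rewrite rmorphM /= P0 mulr0.
exists (Pdiv.Ring.rdivp h P); have he := Pdiv.RingMonic.rdivp_eq Pm h.
rewrite {1}he (free (Pdiv.Ring.rmodp h P)) ?addr0 //.
  by rewrite -ltnS -Ps Pdiv.Ring.ltn_rmodp monic_neq0.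
by move: h0; rewrite he rmorphD rmorphM /= P0 mulr0 add0r -he.
Qed.

Lemma presentation_free y P (h : {poly R}) : presentation y P ->
  (size h <= n)%N -> eval_map sigma y h = 0 -> h = 0.
Proof.
move=> [Pm Ps _ ker] hs /ker[q e]; move: hs; rewrite e.
have [->|q0] := eqVneq q 0; first by rewrite mul0r.
rewrite size_Mmonic // Ps addnS /= leqNgt -[X in (X < _)%N]add0n ltn_add2r.
by rewrite size_poly_gt0 q0.
Qed.

Lemma presentation_top_form y P h1 h2 : presentation y P ->
  eval_map sigma y h1 = eval_map sigma y h2 -> top_form n P h1 = top_form n P h2.
Proof.
move=> [Pm Ps _ ker] e; have /ker[q hq] : eval_map sigma y (h1 - h2) = 0.
  by rewrite rmorphB /= e subrr.
by rewrite -(subrK h2 h1) hq top_formD // top_formMP // add0r.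
Qed.

Lemma transfer_form y1 y2 P1 P2 : presentation y1 P1 -> presentation y2 P2 ->
  exists u, forall h1 h2, eval_map sigma y1 h1 = eval_map sigma y2 h2 ->
    top_form n P1 h1 = top_form n P2 (u * h2).
Proof.
move=> p1 [P2m P2s surj2 ker2]; have [P1m P1s surj1 ker1] := p1.
have [s hs] := choice surj1.
pose l h := top_form n P1 (s (eval_map sigma y2 h)).
have lE h h1 : eval_map sigma y1 h1 = eval_map sigma y2 h -> l h = top_form n P1 h1.
  by move=> e; apply: presentation_top_form p1 _; rewrite hs.
have [||q|u hu] := @top_form_representation R n P2 n0 P2m P2s l.
- by move=> h h'; rewrite -top_formD //; apply: lE; rewrite !rmorphD /= !hs.
- by move=> c h; rewrite -top_formZ //; apply: lE; rewrite !eval_mapZ hs.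
- rewrite (lE _ 0) ?rmorph0; last by apply/esym/ker2; exists q.
  by rewrite -[0](mul0r P1) top_formMP.
by exists u => h1 h2 e; rewrite -hu; apply/esym/lE.
Qed.

(** Both forms generate the dual of [A] as an [A]-module, so each is a multiple of
    the other, and nondegeneracy makes the factors inverse to each other. *)
Lemma top_forms_unit_multiple y1 y2 P1 P2 : presentation y1 P1 -> presentation y2 P2 ->
  exists w w', w * w' = 1 /\ forall h1 h2, eval_map sigma y1 h1 = w * eval_map sigma y2 h2 ->
    top_form n P1 h1 = top_form n P2 h2.
Proof.
move=> p1 p2; have [u2 hu2] := transfer_form p1 p2; have [u1 hu1] := transfer_form p2 p1.
have [P1m P1s surj1 ker1] := p1; have [_ _ surj2 _] := p2.
exists (eval_map sigma y1 u1), (eval_map sigma y2 u2); split=> [|h1 h2 e]; last first.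
  have [h he] := surj1 (eval_map sigma y2 h2); rewrite (hu1 h2 h) //.
  by apply: presentation_top_form p1 _; rewrite e rmorphM /= he.
have [U hU] := surj1 (eval_map sigma y2 u2).
have [|q hq] := @top_form_nondegenerate R n P1 n0 P1m P1s (u1 * U - 1).
  move=> h; have [h2 he] := surj2 (eval_map sigma y1 h).
  rewrite mulrBl mul1r top_formD // -scaleN1r top_formZ // (hu2 h h2) //.
  rewrite (hu1 (u2 * h2) (U * h)) ?mulrA ?mulN1r ?subrr //.
  by rewrite !rmorphM /= hU he.
have /ker1 : exists q, u1 * U - 1 = q * P1 by exists q.
by move/eqP; rewrite rmorphB rmorphM rmorph1 /= hU subr_eq0 => /eqP.
Qed.
End TwoPresentations.

(** This makes the equation of Cayley and Hamilton an equation for [g]. *)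
Lemma horner_mx_action (R A : comNzRingType) (sigma : {rmorphism R -> A}) (m : nat)
    (M : 'M[R]_m.+1) (tau : 'I_m.+1 -> A) (g : A) (q : {poly R}) :
    (forall i, g * tau i = \sum_j sigma (M i j) * tau j) ->
  forall i, eval_map sigma g q * tau i = \sum_j sigma (horner_mx M q i j) * tau j.
Proof.
move=> hg; elim/poly_ind: q => [|q c IH] i.
  by rewrite !rmorph0 mul0r big1 // => j _; rewrite mxE rmorph0 mul0r.
rewrite !rmorphD !rmorphM /= eval_mapX eval_mapC horner_mx_X horner_mx_C mulrDl -mulrA hg.
transitivity (\sum_j sigma (horner_mx M q i j) * (g * tau j) + sigma c * tau i).
  congr (_ + _); rewrite mulrC -hg -mulrA [tau i * _]mulrC IH mulr_sumr.
  by apply: eq_bigr => j _; rewrite mulrCA.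
have -> : sigma c * tau i = \sum_j sigma ((c%:M : 'M_m.+1) i j) * tau j.
  rewrite (bigD1 i) //= mxE eqxx big1 ?addr0 // => j ji.
  by rewrite mxE eq_sym (negbTE ji) rmorph0 mul0r.
rewrite (eq_bigr (fun j => \sum_k sigma (horner_mx M q i j) * sigma (M j k) * tau k)); last first.
  by move=> j _; rewrite hg mulr_sumr; apply: eq_bigr => k _; rewrite mulrA.
rewrite exchange_big -big_split /=; apply: eq_bigr => j _.
rewrite [in RHS]mxE rmorphD mulrDl; congr (_ + _).
rewrite -mulmxE [in RHS]mxE rmorph_sum mulr_suml.
by apply: eq_bigr => k _; rewrite rmorphM.
Qed.

(** * Fraction fields and the degree of a rational function *)
Section Fractions.
Variable R : idomainType.

Lemma repr_den_neq0 (q : {fraction R}) : (repr q).2 != 0.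
Proof. exact: denom_ratioP. Qed.

Lemma fraction_reprE (q : {fraction R}) : q = (repr q).1%:F / (repr q).2%:F.
Proof.
have d0F : (repr q).2%:F != 0 by rewrite tofrac_eq0 repr_den_neq0.
apply: (mulIf d0F); rewrite divfK // -{1}[q]reprK; move: (repr q) => x.
unlock FracField.tofrac.
rewrite -[LHS]FracField.pi_mul; apply/eqmodP => /=.
rewrite FracField.equivfE /FracField.mulf !numden_Ratio ?oner_eq0 ?mulf_neq0 //.
  by rewrite !mulr1 mulrC.
all: by [exact: denom_ratioP | exact: oner_neq0].
Qed.

Lemma fraction_repr (q : {fraction R}) : exists a b : R, b != 0 /\ q = a%:F / b%:F.
Proof. by exists (repr q).1, (repr q).2; rewrite repr_den_neq0 -fraction_reprE. Qed.

Lemma fraction_eq (a b c d : R) : b != 0 -> d != 0 ->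
  (a%:F / b%:F == c%:F / d%:F :> {fraction R}) = (a * d == c * b).
Proof. by move=> b0 d0; rewrite eqr_div ?tofrac_eq0 // -!rmorphM tofrac_eq. Qed.

Lemma common_denominator (h : {poly {fraction R}}) : exists (s : R) (h' : {poly R}),
  s != 0 /\ s%:F *: h = map_poly tofrac h'.
Proof.
elim/poly_ind: h => [|h c [s [h' [s0 e]]]].
  by exists 1, 0; rewrite oner_neq0 scaler0 rmorph0.
have [a [b [b0 ->]]] := fraction_repr c.
exists (s * b), (b *: h' * 'X + (s * a)%:P); split; first by rewrite mulf_neq0.
rewrite [RHS]rmorphD /= [X in _ = X + _]rmorphM /= map_polyX map_polyC /= map_polyZ /= -e.
rewrite scalerDr scalerAl scalerA -tofracM [b * s]mulrC; congr (_ + _).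
rewrite -mul_polyC -polyCM !tofracM; congr (_%:P).
by rewrite -!mulrA [_%:F * (a%:F / _)]mulrC divfK // tofrac_eq0.
Qed.

Variables (L : fieldType) (sigma : {rmorphism R -> L}).

Definition frac_lift of injective sigma := fun q : {fraction R} =>
  sigma (repr q).1 / sigma (repr q).2.
Hypothesis (sigma_inj : injective sigma).
Local Notation lift := (frac_lift sigma_inj).

Lemma sigma_eq0 a : (sigma a == 0) = (a == 0).
Proof. by rewrite -(inj_eq sigma_inj) rmorph0. Qed.

Lemma frac_liftE a b : b != 0 -> lift (a%:F / b%:F) = sigma a / sigma b.
Proof.
move=> b0; rewrite /frac_lift; set q := a%:F / b%:F.
have /eqP := fraction_reprE q; rewrite {1}/q fraction_eq ?repr_den_neq0 // => /eqP e.
by apply/eqP; rewrite eqr_div ?sigma_eq0 ?repr_den_neq0 // -!rmorphM e.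
Qed.

Lemma frac_lift_tofrac a : lift a%:F = sigma a.
Proof. by rewrite -[a%:F]divr1 -tofrac1 frac_liftE ?oner_neq0 // rmorph1 divr1. Qed.

Fact frac_lift_zmod : zmod_morphism lift.
Proof.
move=> p q; have [a [b [b0 ->]]] := fraction_repr p; have [c [d [d0 ->]]] := fraction_repr q.
rewrite !frac_liftE // -mulNr -rmorphN /= addf_div ?tofrac_eq0 //.
rewrite -!rmorphM -rmorphD frac_liftE ?mulf_neq0 // rmorphD !rmorphM rmorphN.
by rewrite -addf_div ?sigma_eq0 // mulNr.
Qed.

Fact frac_lift_monoid : monoid_morphism lift.
Proof.
split=> [|p q]; first by rewrite -tofrac1 frac_lift_tofrac rmorph1.
have [a [b [b0 ->]]] := fraction_repr p; have [c [d [d0 ->]]] := fraction_repr q.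
rewrite mulf_div -!rmorphM !frac_liftE ?mulf_neq0 // !rmorphM /=.
by rewrite mulf_div.
Qed.

HB.instance Definition _ := GRing.isZmodMorphism.Build _ _ lift frac_lift_zmod.
HB.instance Definition _ := GRing.isMonoidMorphism.Build _ _ lift frac_lift_monoid.
End Fractions.

Section FractionDegree.
Variable F : fieldType.
Local Notation K := {fraction {poly F}}.

Definition fdeg (q : K) : int := (size (repr q).1)%:Z - (size (repr q).2)%:Z.

Lemma fdegE (a b : {poly F}) : a != 0 -> b != 0 ->
  fdeg (a%:F / b%:F) = (size a)%:Z - (size b)%:Z.
Proof.
move=> a0 b0; rewrite /fdeg; set q := a%:F / b%:F.
have d0 := repr_den_neq0 q.
have /eqP := fraction_reprE q; rewrite {1}/q fraction_eq // => /eqP e.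
have n0 : (repr q).1 != 0.
  by apply: contraNneq a0 => n0; move/eqP: e; rewrite n0 mul0r mulf_eq0 (negbTE d0) orbF.
have := congr1 (fun p : {poly F} => size p) e; rewrite /= !size_mul //.
move: a0 b0 n0 d0; rewrite -!size_poly_gt0.
move: (size a) (size b) (size (repr q).1) (size (repr q).2) => x y z t; clear; lia.
Qed.

Lemma fdegM (p q : K) : p != 0 -> q != 0 -> fdeg (p * q) = fdeg p + fdeg q.
Proof.
have [a [b [b0 ->]]] := fraction_repr p; have [c [d [d0 ->]]] := fraction_repr q.
rewrite !mulf_eq0 !invr_eq0 !tofrac_eq0 (negbTE b0) (negbTE d0) !orbF => a0 c0.
rewrite mulf_div -!rmorphM !fdegE ?mulf_neq0 // !size_mul //.
move: a0 b0 c0 d0; rewrite -!size_poly_gt0.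
by move: (size a) (size b) (size c) (size d) => x y z t; clear; lia.
Qed.

Lemma common_fraction (p q : K) : exists a c b : {poly F},
  [/\ b != 0, p = a%:F / b%:F & q = c%:F / b%:F].
Proof.
have [a [b [b0 ->]]] := fraction_repr p; have [c [d [d0 ->]]] := fraction_repr q.
exists (a * d), (c * b), (b * d); rewrite mulf_neq0 //; split=> //.
  by rewrite !rmorphM /= -mulf_div divff ?mulr1 // tofrac_eq0.
by rewrite [b * d]mulrC !rmorphM /= -mulf_div divff ?mulr1 // tofrac_eq0.
Qed.

Lemma val_le_fdegE (a b : {poly F}) z : b != 0 ->
  val_le fdeg (a%:F / b%:F) z = ((a == 0) || ((size a)%:Z <= z + (size b)%:Z)).
Proof.
move=> b0; rewrite /val_le mulf_eq0 invr_eq0 !tofrac_eq0 (negbTE b0) orbF.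
by have [//|a0] := eqVneq a 0; rewrite fdegE // lerBlDr.
Qed.

Lemma fdegD (p q : K) z : val_le fdeg p z -> val_le fdeg q z -> val_le fdeg (p + q) z.
Proof.
have [a [c [b [b0 -> ->]]]] := common_fraction p q.
rewrite -mulrDl -rmorphD !val_le_fdegE //.
have [->|a0] := eqVneq a 0; first by rewrite add0r.
have [->|c0] := eqVneq c 0; first by rewrite addr0 (negbTE a0).
move=> /= az cz; apply/orP; right; have := size_polyD a c.
by move: az cz; move: (size a) (size c) (size b) (size (a + c)%R) => x y t w; lia.
Qed.

Lemma fdeg_residue (p q : K) : p != 0 -> q != 0 -> fdeg p = fdeg q ->
  exists c : F, let r := p - c%:P%:F * q in r = 0 \/ fdeg r < fdeg p.
Proof.
have [a [c [b [b0 -> ->]]]] := common_fraction p q.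
rewrite !mulf_eq0 !invr_eq0 !tofrac_eq0 (negbTE b0) !orbF => a0 c0.
rewrite !fdegE // => e; have {e} sz : size a = size c by lia.
exists (lead_coef a / lead_coef c) => /=.
rewrite mulrA -rmorphM -mulrBl -rmorphB.
set d := lead_coef a / lead_coef c; have [->|r0] := eqVneq (a - d%:P * c) 0.
  by left; rewrite rmorph0 mul0r.
right; rewrite !fdegE // ltrD2r ltz_nat mul_polyC.
have sa : (0 < size a)%N by rewrite size_poly_gt0.
rewrite -[X in (_ < X)%N](prednK sa) ltnS; apply/leq_sizeP => j.
rewrite leq_eqVlt => /orP[/eqP<-|sj].
  by rewrite coefB coefZ {2}sz -!lead_coefE /d divfK ?subrr ?lead_coef_eq0.
rewrite prednK // in sj.
by rewrite coefB coefZ !nth_default ?mulr0 ?subrr // -sz.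
Qed.

Lemma fdeg_tofrac (p : {poly F}) : p != 0 -> fdeg p%:F = (size p)%:Z - 1.
Proof. by move=> p0; rewrite -[p%:F]divr1 -tofrac1 fdegE ?oner_neq0 // size_poly1. Qed.
End FractionDegree.

(** * Embeddings of the line: lowering the degree *)
Section Embedding.
Variables (F : fieldType) (f g : {poly F}) (n : nat) (H : {poly {poly F}}).
Hypotheses (fs : size f = n.+1) (n1 : (1 < n)%N)
  (fgX : eval_map (comp_poly f) g H = 'X).
Local Notation R := {poly F}.
Local Notation K := {fraction {poly F}}.
Local Notation evR y := (eval_map (comp_poly f) y).

Let n0 : (0 < n)%N. Proof. exact: ltnW. Qed.

Lemma size_compf (p : R) : p != 0 -> size (p \Po f) = ((size p).-1 * n).+1.
Proof.
move=> p0; have f1 : (1 < size f)%N by rewrite fs.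
by rewrite polySpred ?comp_poly_eq0 // size_comp_poly fs.
Qed.

Definition frac_comp (p : R) : K := (p \Po f)%:F.
HB.instance Definition _ := GRing.RMorphism.copy frac_comp (tofrac \o comp_poly f).

Lemma frac_comp_inj : injective frac_comp.
Proof.
move=> p q /eqP; rewrite tofrac_eq -subr_eq0 -rmorphB /= => /eqP e.
by apply/eqP; rewrite -subr_eq0 -(@comp_poly_eq0 _ _ f) ?e // fs.
Qed.

(** The embedding of [F(x)] in [F(t)] that sends [x] to [f]. *)
Definition phi := frac_lift frac_comp_inj.
HB.instance Definition _ := GRing.RMorphism.copy phi (frac_lift frac_comp_inj).
Local Notation ev y := (eval_map phi y%:F).

Lemma ev_map (y : R) (h : {poly R}) : ev y (map_poly tofrac h) = (evR y h)%:F.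
Proof.
rewrite /eval_map -map_poly_comp -horner_map /= -map_poly_comp; congr (_.[_]).
by apply: eq_map_poly => c /=; rewrite /phi frac_lift_tofrac.
Qed.

Lemma fdeg_phi (a b : R) : a != 0 -> b != 0 ->
  fdeg (phi (a%:F / b%:F)) = ((size a)%:Z - (size b)%:Z) * n%:Z.
Proof.
move=> a0 b0; rewrite /phi frac_liftE // /= fdegE; last 2 first.
- by rewrite -size_poly_gt0 size_compf.
- by rewrite -size_poly_gt0 size_compf.
rewrite !size_compf //.
by move: a0 b0; rewrite -!size_poly_gt0; case: (size a) => // x _; case: (size b) => // z _ /=; lia.
Qed.

Lemma phi_value_dvd c : c != 0 -> (n %| fdeg (phi c))%Z.
Proof.
have [a [b [b0 ->]]] := fraction_repr c.
rewrite mulf_eq0 invr_eq0 !tofrac_eq0 (negbTE b0) orbF => a0.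
by rewrite fdeg_phi // dvdz_mull.
Qed.

Lemma phi_value_surj z : (n %| z)%Z -> exists2 c, c != 0 & fdeg (phi c) = z.
Proof.
move=> /dvdzP[q ->]; have X0 i : 'X^i != 0 :> R by rewrite monic_neq0 ?monicXn.
have c0 i j : ('X^i)%:F / ('X^j)%:F != 0 :> K.
  by rewrite mulf_neq0 ?invr_eq0 ?tofrac_eq0.
by case: q => q; [exists (('X^q : R)%:F / ('X^0 : R)%:F) | exists (('X^0 : R)%:F / ('X^(q.+1) : R)%:F)];
  rewrite ?c0 // fdeg_phi // !size_polyXn; lia.
Qed.

Lemma level_phi y : level phi (@fdeg F) y n 1.
Proof. exact: level_base phi_value_dvd phi_value_surj. Qed.

(** The powers of [t] below [n] have distinct degrees modulo [n], and elements of
    [F(f)] have degrees divisible by [n]. *)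
Lemma X_expansion i (h : {poly K}) : (i <= n)%N -> h != 0 -> (size h <= i)%N ->
  ev 'X h != 0 /\ exists2 j, (j < i)%N & (n %| fdeg (ev 'X h) - j%:Z)%Z.
Proof.
move=> il h0 hs.
have fX : fdeg ('X : R)%:F = 1 by rewrite fdeg_tofrac ?polyX_eq0 // size_polyX.
have [||||e0 [j ji jd]] := @expansion_values _ _ phi (@fdeg F) (@fdegM F) (@fdegD F)
  ('X)%:F n 1 n 'X 1 (level_phi _) (monicX _) (size_polyX _) _ _ _ i h il h0.
- by rewrite eval_mapX tofrac_eq0 polyX_eq0.
- by rewrite eval_mapX.
- move=> j /andP[j0 jn]; rewrite natz dvdzE /=; apply/negP => /dvdn_leq.
  by move=> /(_ j0); rewrite leqNgt jn.
- by rewrite muln1.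
by split=> //; exists j => //; rewrite natz in jd.
Qed.

Lemma X_free (h : {poly R}) : (size h <= n)%N -> evR 'X h = 0 -> h = 0.
Proof.
move=> hs e; apply/eqP/negPn/negP => h0.
have m0 : map_poly tofrac h != 0 by rewrite map_poly_eq0_id0 ?tofrac_eq0 ?lead_coef_eq0.
have [|/negP] := X_expansion (leqnn n) m0; first by rewrite size_map_inj_poly ?rmorph0 // => ? ? /eqP; rewrite tofrac_eq => /eqP.
by rewrite ev_map tofrac_eq0 e eqxx.
Qed.

(** The minimal polynomial of [t] over [F(f)]. *)
Definition fiber_poly : {poly R} :=
  map_poly polyC ((lead_coef f)^-1 *: f) - ((lead_coef f)^-1 *: 'X)%:P.

Lemma presentation_X : presentation (comp_poly f) n 'X fiber_poly.
Proof.
have lc0 : lead_coef f != 0 by rewrite lead_coef_eq0 -size_poly_gt0 fs.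
have m1 : map_poly polyC ((lead_coef f)^-1 *: f) \is monic.
  by rewrite monic_map // monicE lead_coefZ mulVf.
have s1 : size (map_poly polyC ((lead_coef f)^-1 *: f)) = n.+1.
  by rewrite size_map_polyC size_scale ?invr_eq0.
have [|m2 s2] := @monicD_small _ _ (- ((lead_coef f)^-1 *: 'X)%:P) n m1 s1.
  by rewrite size_polyN; apply: leq_trans (size_polyC_leq1 _) _.
have evC (z : R) : evR 'X (map_poly polyC z) = z.
  rewrite /eval_map -map_poly_comp -[RHS]comp_polyXr; congr (_.[_]).
  by apply: eq_map_poly => c /=; rewrite comp_polyC.
apply: presentation_intro => //.
- by rewrite rmorphB /= evC eval_mapC /= comp_polyZ comp_polyX subrr.
- by move=> a; exists (map_poly polyC a).
- exact: X_free.
Qed.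

(** [P] is the characteristic polynomial of the multiplication by [g]. It follows
    that the [n] powers of [g] below [n] generate the free module [F[t]] of rank
    [n] over [F[f]], so they form a basis: a one-sided inverse of a square matrix
    is two-sided. *)
Lemma exists_presentation_g : exists P, presentation (comp_poly f) n g P.
Proof.
have surj (z : R) : exists h : {poly R}, evR g h = z.
  exists (@eval_map F {poly {poly F}} (@polyCC F) H z).
  rewrite (rmorph_eval_map (tau := polyC)) => [|c]; last by rewrite /= eval_mapC /= comp_polyC.
  by rewrite /= fgX -[RHS]comp_polyXr.
have cX (z : R) : exists2 h : {poly R}, (size h <= n)%N & evR 'X h = z.
  exact: presentation_small presentation_X.
have [m nm] : exists m, n = m.+1 by exists n.-1; rewrite prednK.
have X_ (z : R) : {h : {poly R} | (size h <= n)%N /\ evR 'X h = z}.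
  by apply: cid; have [h hs he] := cX z; exists h.
pose cd (z : R) : {poly R} := sval (X_ z).
have cds (z : R) : (size (cd z) <= n)%N by rewrite /cd; case: (X_ z) => h [].
have cdE (z : R) : evR 'X (cd z) = z by rewrite /cd; case: (X_ z) => h [].
pose M := \matrix_(i < m.+1, j < m.+1) (cd (g * 'X^i))`_j.
have evX (h : {poly R}) : (size h <= n)%N -> evR 'X h = \sum_(i < m.+1) (h`_i \Po f) * 'X^i.
  by rewrite nm => hs; rewrite (eval_map_coef _ _ hs).
have act (i : 'I_m.+1) : g * 'X^i = \sum_j comp_poly f (M i j) * 'X^j.
  by rewrite -[LHS]cdE evX //; apply: eq_bigr => j _; rewrite mxE.
exists (char_poly M); have P0 : evR g (char_poly M) = 0.
  have := horner_mx_action (char_poly M) act ord0.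
  rewrite Cayley_Hamilton expr0 mulr1 => ->.
  by rewrite big1 // => j _; rewrite mxE rmorph0 mul0r.
have Ps : size (char_poly M) = n.+1 by rewrite size_char_poly nm.
apply: presentation_intro => //; first exact: char_poly_monic.
move=> h hs h0.
have smallg (z : R) : exists2 T : {poly R}, (size T <= n)%N & evR g T = z.
  have [T <-] := surj z; exists (Pdiv.Ring.rmodp T (char_poly M)).
    by rewrite -ltnS -Ps Pdiv.Ring.ltn_rmodp monic_neq0 ?char_poly_monic.
  rewrite [in RHS](Pdiv.RingMonic.rdivp_eq (char_poly_monic M) T) rmorphD rmorphM /=.
  by rewrite P0 mulr0 add0r.
have sm (i : 'I_m.+1) : exists T : {poly R}, (size T <= n)%N /\ evR g T = 'X^i.
  by have [T Ts Te] := smallg 'X^i; exists T.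
have [T_ hT] := choice sm.
pose Tm := \matrix_(i < m.+1, j < m.+1) (T_ i)`_j.
pose Gm := \matrix_(i < m.+1, j < m.+1) (cd (g ^+ i))`_j.
have comb (p : {poly R}) : (size p <= n)%N ->
    evR 'X (\sum_(j < m.+1) p`_j *: cd (g ^+ j)) = evR g p.
  rewrite nm => ps; rewrite (eval_map_coef _ _ ps) rmorph_sum; apply: eq_bigr => j _.
  by rewrite /= eval_mapZ cdE.
have combs (p : {poly R}) : (size (\sum_(j < m.+1) p`_j *: cd (g ^+ j))%R <= n)%N.
  apply: leq_trans (size_sum _ _ _) _; apply/bigmax_leqP => j _.
  exact: leq_trans (size_scale_leq _ _) _.
have TG : Tm *m Gm = 1%:M.
  apply/matrixP => i k; rewrite !mxE.
  have [Ts Te] := hT i.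
  have e : \sum_(j < m.+1) (T_ i)`_j *: cd (g ^+ j) = 'X^i.
    apply/eqP; rewrite -subr_eq0; apply/eqP/X_free; last first.
      by rewrite rmorphB /= comb // Te eval_mapXn subrr.
    apply: leq_trans (size_polyD _ _) _; rewrite geq_max combs size_polyN size_polyXn.
    by rewrite /= nm ltn_ord.
  have := congr1 (fun p : {poly R} => p`_k) e; rewrite /= coefXn coef_sum eq_sym => <-.
  by apply: eq_bigr => j _; rewrite !mxE coefZ.
pose hv := \row_(j < m.+1) h`_j.
have hG : hv *m Gm = 0.
  have e : \sum_(j < m.+1) h`_j *: cd (g ^+ j) = 0 by apply: X_free; rewrite ?comb.
  apply/rowP => k; rewrite !mxE.
  have := congr1 (fun p : {poly R} => p`_k) e; rewrite /= coef0 coef_sum => e'; rewrite -[RHS]e'.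
  by apply: eq_bigr => j _; rewrite !mxE coefZ.
have : hv = 0 by rewrite -[hv]mulmx1 -(mulmx1C TG) mulmxA hG mul0mx.
move/rowP => hv0; apply/polyP => i; rewrite coef0.
case: (ltnP i m.+1) => im; first by have := hv0 (Ordinal im); rewrite !mxE.
by rewrite nth_default // (leq_trans hs) // nm.
Qed.

Lemma ev_g_common_denominator (h : {poly K}) : h != 0 -> (size h <= n)%N ->
  exists s h', [/\ s != 0, s%:F *: h = map_poly tofrac h', size h' = size h,
    evR g h' != 0 & ev g h != 0].
Proof.
move=> h0 hs; have [s [h' [s0 e]]] := common_denominator h.
have s0F : s%:F != 0 :> K by rewrite tofrac_eq0.
have sh : size h' = size h.
  rewrite -(size_scale h s0F) e size_map_inj_poly ?rmorph0 //.
  by move=> x z /eqP; rewrite tofrac_eq => /eqP.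
have h'0 : h' != 0 by rewrite -size_poly_gt0 sh size_poly_gt0.
have [P prP] := exists_presentation_g.
have z0 : evR g h' != 0.
  apply: contraNneq h'0 => z0; apply/eqP.
  by apply: presentation_free prP _ z0; rewrite sh.
exists s, h'; split; [exact: s0|exact: e|exact: sh|exact: z0|].
apply: contraNneq z0 => z0.
by rewrite -tofrac_eq0 -ev_map -e eval_mapZ z0 mulr0.
Qed.

Lemma ev_g_neq0 (h : {poly K}) : h != 0 -> (size h <= n)%N -> ev g h != 0.
Proof. by move=> h0 hs; have [s [h' []]] := ev_g_common_denominator h0 hs. Qed.

(** A degree congruent to [-1] modulo [n] can only come from the coordinate on
    [t ^ n.-1], and this coordinate vanishes because, up to a constant, it is the
    coordinate on [g ^ n.-1]. *)
Lemma value_gap (h : {poly K}) : h != 0 -> (size h <= n.-1)%N ->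
  ~~ (n %| fdeg (ev g h) + 1)%Z.
Proof.
move=> h0 hs; have hsn := leq_trans hs (leq_pred n).
have [s [h' [s0 e sh z0 eh0]]] := ev_g_common_denominator h0 hsn.
have [P prP] := exists_presentation_g.
have [w [w' [ww' hw]]] := top_forms_unit_multiple n0 presentation_X prP.
set z := evR g h' in z0.
have w0 : w != 0 by apply: contra_eq_neq ww' => ->; rewrite mul0r eq_sym oner_neq0.
have w'0 : w' != 0 by apply: contra_eq_neq ww' => ->; rewrite mulr0 eq_sym oner_neq0.
have ws : size w = 1%N.
  have := congr1 (fun p : {poly F} => size p) ww'; rewrite /= size_poly1 size_mul //.
  by move: w0 w'0; rewrite -!size_poly_gt0; move: (size w) (size w') => a b; clear; lia.
have [h1 h1s h1e] := presentation_small (w * z) presentation_X.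
have top : h1`_n.-1 = 0.
  rewrite -(@top_form_small _ n fiber_poly) //; last by case: presentation_X.
  rewrite (hw h1 h' h1e) top_form_small //; last 2 first.
  - by case: prP.
  - by rewrite sh.
  by rewrite nth_default // sh.
have h1s' : (size h1 <= n.-1)%N.
  apply/leq_sizeP => j; rewrite leq_eqVlt => /orP[/eqP<- //|nj].
  by rewrite nth_default //; apply: leq_trans h1s _; rewrite -(prednK n0).
have wz0 : w * z != 0 by rewrite mulf_neq0.
have h10 : h1 != 0 by apply: contra_neq wz0 => h10; rewrite -h1e h10 rmorph0.
have inj : injective (@FracField.tofrac {poly F}).
  by move=> x t /eqP; rewrite tofrac_eq => /eqP.
have m0 : map_poly tofrac h1 != 0.
  by rewrite -size_poly_gt0 size_map_inj_poly ?rmorph0 // size_poly_gt0.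
have [|_ [j jn]] := X_expansion (leq_pred n) m0.
  by rewrite size_map_inj_poly ?rmorph0.
rewrite ev_map h1e fdeg_tofrac // size_mul // ws add1n /= => jd.
have s0F : s%:F != 0 :> K by rewrite tofrac_eq0.
have ps0 : phi s%:F != 0 by rewrite fmorph_eq0.
have vz : fdeg (z%:F) = fdeg (phi s%:F) + fdeg (ev g h).
  have -> : z%:F = phi s%:F * ev g h.
    by rewrite /z -(ev_map g h') -e (eval_mapZ phi g%:F).
  exact: fdegM ps0 eh0.
apply/negP => d; have : (n %| j.+1)%N.
  rewrite -[n]/`|n%:Z|%N -[X in (_ %| X)%N]/`|j.+1%:Z|%N -dvdzE.
  have -> : j.+1%:Z = fdeg (phi s%:F) + (fdeg (ev g h) + 1) - ((size z)%:Z - 1 - j%:Z).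
    by rewrite -(fdeg_tofrac z0) vz; ring.
  have sd := phi_value_dvd s0F.
  by rewrite rpredB // rpredD.
move/dvdn_leq => /(_ isT); rewrite leqNgt.
by move: jn; rewrite -{2}(prednK n0) ltnS => ->.
Qed.

Hypothesis char0 : [pchar F] =i pred0.

Lemma embedding_reduction_large : exists b : R, (size (g + (b \Po f))%R <= n)%N.
Proof.
have natF m : (0 < m)%N -> m%:R != 0 :> F.
  by rewrite (proj1 (pcharf0P F)) // lt0n.
have [P prP] := exists_presentation_g.
have [h0 h0s h0e] := presentation_small ('X^(n.-1) : R) prP.
have [Pm Ps _ _] := prP.
have inj : injective (@FracField.tofrac {poly F}).
  by move=> x t /eqP; rewrite tofrac_eq => /eqP.
have X0 : 'X^(n.-1) != 0 :> R by rewrite monic_neq0 ?monicXn.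
have phiF (p : R) : phi p%:F = (p \Po f)%:F by rewrite /phi frac_lift_tofrac.
have [|||||||b] := @degree_reduction K K phi (@fdeg F) (@fdegM F) (@fdegD F) g%:F
  R tofrac n P h0 inj n1 _ _ _ phi_value_dvd phi_value_surj ev_g_neq0 Pm Ps _ _ h0s _ _ value_gap.
- move=> m m0; exists (m%:R^-1)%:P.
  by rewrite -polyC1 -polyCMn -polyCM mulVf ?natF.
- move=> m m0; rewrite rmorph_nat -tofrac1 -rmorphMn /=.
  have -> : (1 *+ m : R) = (m%:R)%:P by rewrite polyCMn.
  by rewrite fdeg_tofrac ?polyC_eq0 ?natF // size_polyC natF.
- move=> a c a0 c0 /(fdeg_residue a0 c0)[d] /= hd; exists (d%:P)%:F.
  by rewrite phiF comp_polyC.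
- rewrite ev_map.
  have [_ _ _ ker] := prP; have -> : evR g P = 0 by apply/ker; exists 1; rewrite mul1r.
  by rewrite rmorph0.
- by move=> h; rewrite ev_map tofrac_eq0 => e; rewrite fdeg_tofrac // subr_ge0 lez_nat size_poly_gt0.
- by rewrite ev_map h0e tofrac_eq0.
- by rewrite ev_map h0e fdeg_tofrac // size_polyXn prednK.
rewrite /= phiF -rmorphD => gb; exists b.
have [->|c0] := eqVneq (g + (b \Po f)) 0; first by rewrite size_poly0.
by move: gb; rewrite fdeg_tofrac // lerD2r lez_nat.
Qed.

End Embedding.

(** * Substitutions and coordinates in two variables *)
Section Bivariate.
Variables (S A : comNzRingType) (sigma : {rmorphism S -> A}) (a b : A).

Definition eval2 (p : {poly {poly S}}) : A := @eval_map {poly S} A (@eval_map S A sigma a) b p.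
HB.instance Definition _ :=
  GRing.RMorphism.copy eval2 (@eval_map {poly S} A (@eval_map S A sigma a) b).

Lemma eval2D p q : eval2 (p + q) = eval2 p + eval2 q. Proof. exact: rmorphD. Qed.
Lemma eval2B p q : eval2 (p - q) = eval2 p - eval2 q. Proof. exact: rmorphB. Qed.
Lemma eval2M p q : eval2 (p * q) = eval2 p * eval2 q. Proof. exact: rmorphM. Qed.
Lemma eval2P (c : {poly S}) : eval2 c%:P = eval_map sigma a c.
Proof. exact: eval_mapC. Qed.
Lemma eval2C c : eval2 (polyCC c) = sigma c.
Proof. by rewrite eval2P eval_mapC. Qed.
Lemma eval2X : eval2 'X%:P = a.
Proof. by rewrite eval2P eval_mapX. Qed.
Lemma eval2Y : eval2 'X = b.
Proof. exact: eval_mapX. Qed.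
End Bivariate.

(** Identities between substitutions are checked on constants and variables. *)
Lemma bipoly_rmorph_eq (S A : comNzRingType) (r1 r2 : {rmorphism {poly {poly S}} -> A}) :
    (forall c, r1 (polyCC c) = r2 (polyCC c)) -> r1 'X%:P = r2 'X%:P -> r1 'X = r2 'X ->
  r1 =1 r2.
Proof.
move=> eC eX eY; elim/poly_ind => [|p c IH]; first by rewrite !rmorph0.
rewrite !rmorphD !rmorphM /= eY IH; congr (_ + _).
elim/poly_ind: c => [|q c IHc]; first by rewrite !rmorph0.
by rewrite polyCD polyCM !rmorphD !rmorphM /= eX IHc eC.
Qed.

Lemma rmorph_eval2 (S A B : comNzRingType) (sigma : {rmorphism S -> A})
    (rho : {rmorphism A -> B}) (tau : {rmorphism S -> B}) (a b : A) p :
  (forall c, rho (sigma c) = tau c) -> rho (eval2 sigma a b p) = eval2 tau (rho a) (rho b) p.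
Proof.
move=> e; apply: (@bipoly_rmorph_eq S B (rho \o eval2 sigma a b) (eval2 tau (rho a) (rho b))).
- by move=> c; rewrite /= !eval2C.
- by rewrite /= !eval2X.
- by rewrite /= !eval2Y.
Qed.

Section Automorphism.
Variable S : comNzRingType.
Implicit Types g h p q : {poly {poly S}}.

Definition subst2 g h p : {poly {poly S}} :=
  @eval2 S {poly {poly S}} (@polyCC S) g h p.
HB.instance Definition _ g h :=
  GRing.RMorphism.copy (subst2 g h) (@eval2 S {poly {poly S}} (@polyCC S) g h).

Lemma subst2D g h p q : subst2 g h (p + q) = subst2 g h p + subst2 g h q.
Proof. exact: rmorphD. Qed.
Lemma subst2B g h p q : subst2 g h (p - q) = subst2 g h p - subst2 g h q.
Proof. exact: rmorphB. Qed.
Lemma subst2M g h p q : subst2 g h (p * q) = subst2 g h p * subst2 g h q.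
Proof. exact: rmorphM. Qed.
Lemma subst2C g h c : subst2 g h (polyCC c) = polyCC c.
Proof. exact: (@eval2C S {poly {poly S}} (@polyCC S)). Qed.
Lemma subst2X g h : subst2 g h 'X%:P = g.
Proof. exact: (@eval2X S {poly {poly S}} (@polyCC S)). Qed.
Lemma subst2Y g h : subst2 g h 'X = h.
Proof. exact: (@eval2Y S {poly {poly S}} (@polyCC S)). Qed.

Lemma eval2_subst2 (A : comNzRingType) (sigma : {rmorphism S -> A}) (a b : A) g h p :
  eval2 sigma a b (subst2 g h p) = eval2 sigma (eval2 sigma a b g) (eval2 sigma a b h) p.
Proof.
apply: (@rmorph_eval2 S {poly {poly S}} A (@polyCC S) (eval2 sigma a b) sigma) => c.
exact: eval2C.
Qed.

Lemma subst2_id p : subst2 'X%:P 'X p = p.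
Proof.
apply: (@bipoly_rmorph_eq S {poly {poly S}} (subst2 'X%:P 'X) idfun) => [c||].
- exact: subst2C.
- exact: subst2X.
- exact: subst2Y.
Qed.

Lemma subst2_comp g h g' h' p :
  subst2 g h (subst2 g' h' p) = subst2 (subst2 g h g') (subst2 g h h') p.
Proof. exact: (@eval2_subst2 {poly {poly S}} (@polyCC S)). Qed.

(** The inverse substitution is given with both composites, so that it does not
    have to be recovered from surjectivity. *)
Definition coordinate_pair g h := exists gx gy,
  [/\ subst2 gx gy g = 'X%:P, subst2 gx gy h = 'X,
      subst2 g h gx = 'X%:P & subst2 g h gy = 'X].

Lemma coordinate_pair_comp g h g' h' : coordinate_pair g h -> coordinate_pair g' h' ->
  coordinate_pair (subst2 g h g') (subst2 g h h').
Proof.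
move=> [gx [gy [e1 e2 e3 e4]]] [gx' [gy' [e1' e2' e3' e4']]].
exists (subst2 gx' gy' gx), (subst2 gx' gy' gy).
have K p : subst2 gx gy (subst2 g h p) = p by rewrite subst2_comp e1 e2 subst2_id.
have K' p : subst2 g' h' (subst2 gx' gy' p) = p by rewrite subst2_comp e3' e4' subst2_id.
by split; rewrite -subst2_comp ?K ?K'.
Qed.

Lemma coordinate_pair_swap : coordinate_pair ('X : {poly {poly S}}) 'X%:P.
Proof. by exists 'X, 'X%:P; rewrite !subst2X !subst2Y. Qed.

Lemma subst2P g h (c : {poly S}) : subst2 g h c%:P = @eval_map S {poly {poly S}} (@polyCC S) g c.
Proof. exact: (@eval2P S {poly {poly S}} (@polyCC S)). Qed.

Lemma eval_map_polyCC_X (c : {poly S}) : @eval_map S {poly {poly S}} (@polyCC S) 'X%:P c = c%:P.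
Proof. by rewrite -(subst2P 'X%:P 'X) subst2_id. Qed.

Lemma coordinate_pair_elementary (c : {poly S}) : coordinate_pair ('X%:P : {poly {poly S}}) ('X + c%:P).
Proof.
have E d : subst2 'X%:P ('X + d%:P) ('X - d%:P) = 'X :> {poly {poly S}}.
  by rewrite rmorphB /= subst2Y subst2P eval_map_polyCC_X addrK.
exists 'X%:P, ('X - c%:P); rewrite !subst2X E; split=> //.
by have := E (- c); rewrite polyCN opprK.
Qed.

Lemma coordinate_pair_scale (u w : S) : u * w = 1 ->
  coordinate_pair ('X%:P : {poly {poly S}}) (polyCC w * 'X).
Proof.
move=> uw; have E x y : x * y = 1 -> subst2 'X%:P (polyCC x * 'X) (polyCC y * 'X) = 'X.
  move=> xy; rewrite rmorphM /= subst2C subst2Y mulrA -rmorphM mulrC /= [y * x]mulrC xy.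
  by rewrite rmorph1 mulr1.
exists 'X%:P, (polyCC u * 'X); rewrite !subst2X E ?E //.
by rewrite mulrC.
Qed.
End Automorphism.

(** * Rectification of embedded lines *)
Section Plane.
Variable F : fieldType.
Hypothesis char0 : [pchar F] =i pred0.
Implicit Types X Y : {poly F}.

(** Abhyankar-Moh-Suzuki; degree one, where [t] itself is a polynomial in [X], is
    treated apart. *)
Lemma embedding_reduction X Y (H : {poly {poly F}}) : (1 < size X)%N -> eval_map (comp_poly X) Y H = 'X ->
  exists b : {poly F}, (size (Y + (b \Po X))%R < size X)%N.
Proof.
move=> X1 e; case: (ltnP 2 (size X)) => X2.
  have sX : size X = (size X).-1.+1 by rewrite prednK // ltnW.
  have n1 : (1 < (size X).-1)%N by rewrite -ltnS -sX.
  have [b hb] := embedding_reduction_large sX n1 e char0.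
  by exists b; rewrite sX ltnS.
have {X1 X2} sX : size X = 2%N by apply/eqP; rewrite eqn_leq X2 X1.
have a0 : X`_1 != 0 by rewrite -[1%N]/(2.-1) -sX -lead_coefE lead_coef_eq0 -size_poly_gt0 sX.
exists (- (Y \Po ((X`_1)^-1 *: ('X - (X`_0)%:P)))).
rewrite [_ \Po X]rmorphN /= -comp_polyA comp_polyZ comp_polyB comp_polyX comp_polyC.
have -> : (X`_1)^-1 *: (X - (X`_0)%:P) = 'X.
  apply/polyP => i; rewrite coefZ coefB coefC coefX.
  case: i => [|[|i]] /=; rewrite ?subrr ?mulr0 ?subr0 ?mulVf //.
  by rewrite (@nth_default _ 0 X i.+2) ?sX // mulr0.
by rewrite comp_polyXr subrr size_poly0 sX.
Qed.

Lemma poly_inverse_const (D : idomainType) (p q : {poly D}) : p * q = 1 ->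
  exists a b, [/\ p = a%:P, q = b%:P & a * b = 1].
Proof.
move=> pq; have p0 : p != 0 by apply: contra_eq_neq pq => ->; rewrite mul0r eq_sym oner_neq0.
have q0 : q != 0 by apply: contra_eq_neq pq => ->; rewrite mulr0 eq_sym oner_neq0.
have := congr1 (fun h : {poly D} => size h) pq; rewrite /= size_poly1 size_mul //.
move=> s; have [ps qs] : (size p <= 1)%N /\ (size q <= 1)%N.
  by move: p0 q0 s; rewrite -!size_poly_gt0; move: (size p) (size q) => x y; clear; lia.
exists p`_0, q`_0; rewrite -!size1_polyC //; split=> //; apply: polyC_inj.
by rewrite polyCM -!size1_polyC // pq.
Qed.

Definition rectifiable X Y := exists U V,
  [/\ coordinate_pair U V, eval2 (@polyC F) X Y U = 'X & eval2 (@polyC F) X Y V = 0].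

Lemma rectifiable_auto X Y g h : coordinate_pair g h ->
  rectifiable (eval2 (@polyC F) X Y g) (eval2 (@polyC F) X Y h) -> rectifiable X Y.
Proof.
move=> gh [U [V [UV eU eV]]]; exists (subst2 g h U), (subst2 g h V).
by rewrite !eval2_subst2; split=> //; apply: coordinate_pair_comp.
Qed.

Lemma generates_auto X Y g h H : coordinate_pair g h -> eval2 (@polyC F) X Y H = 'X ->
  exists H', eval2 (@polyC F) (eval2 (@polyC F) X Y g) (eval2 (@polyC F) X Y h) H' = 'X.
Proof.
move=> [gx [gy [e1 e2 e3 e4]]] e; exists (subst2 gx gy H).
by rewrite -eval2_subst2 subst2_comp e3 e4 subst2_id.
Qed.

(** As long as neither coordinate is constant, the larger degree is lowered by a
    triangular substitution. When [X] is constant, [Y] has degree one. *)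
Lemma line_rectifiable X Y H : eval2 (@polyC F) X Y H = 'X -> rectifiable X Y.
Proof.
have [m] := ubnP (size X + size Y); elim: m X Y H => // m IH X Y H.
wlog XY : X Y H / (size X <= size Y)%N => [W|] ltm e.
  case: (leqP (size X) (size Y)) => XY; first exact: W XY ltm e.
  have [H' e'] := generates_auto (coordinate_pair_swap F) e.
  apply: (rectifiable_auto (coordinate_pair_swap F)); rewrite eval2Y eval2X in e' *.
  by apply: W e'; rewrite 1?addnC // ltnW.
case: (ltnP 1 (size X)) => X1.
  have [b hb] := @embedding_reduction X Y H X1 e.
  have [H' e'] := generates_auto (coordinate_pair_elementary b) e.
  apply: (rectifiable_auto (coordinate_pair_elementary b)).
  have eb : eval2 (@polyC F) X Y ('X + b%:P) = Y + (b \Po X).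
    by rewrite rmorphD /= eval2Y eval2P.
  rewrite eval2X eb in e' *; apply: IH e'.
  rewrite ltnS in ltm; apply: leq_trans ltm; rewrite ltn_add2l.
  exact: leq_trans hb XY.
have [c Xc] : exists c, X = c%:P by exists X`_0; apply: size1_polyC.
have sY : size Y = 2%N.
  have eH : (map_poly (horner_eval c) H) \Po Y = 'X.
    rewrite -e Xc /eval2 /eval_map /comp_poly -map_poly_comp; congr (_.[_]).
    apply: eq_map_poly => d /=; rewrite /horner_eval.
    by rewrite -[RHS]/(d \Po c%:P) comp_polyCr.
  have := size_comp_poly (map_poly (horner_eval c) H) Y.
  rewrite eH size_polyX /= => /esym/eqP; rewrite muln_eq1 => /andP[_ /eqP].
  by case: (size Y) => // k /= ->.
have a0 : Y`_1 != 0 by rewrite -[1%N]/(2.-1) -sY -lead_coefE lead_coef_eq0 -size_poly_gt0 sY.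
have EY : Y = (Y`_0)%:P + Y`_1 *: 'X.
  apply/polyP => i; rewrite coefD coefC coefZ coefX.
  case: i => [|[|i]] /=; rewrite ?mulr0 ?mulr1 ?addr0 ?add0r //.
  by rewrite (@nth_default _ 0 Y i.+2) ?sY.
set a := Y`_1 in a0 EY; set b := Y`_0 in EY.
exists (polyCC a^-1 * ('X - polyCC b)), ('X%:P - polyCC c); split.
- have ua : polyCC a^-1 * polyCC a = 1 :> {poly {poly F}}.
    by rewrite /polyCC -!polyCM mulVf.
  exists ('X + polyCC c), (polyCC a * 'X%:P + polyCC b); split.
  + rewrite subst2M subst2B !subst2C subst2Y addrK mulrA ua; exact: mul1r.
  + by rewrite subst2B subst2C subst2X addrK.
  + by rewrite subst2D subst2C subst2Y subrK.
  + by rewrite subst2D subst2M !subst2C subst2X mulrA [polyCC a * _]mulrC ua mul1r subrK.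
- rewrite eval2M eval2B !eval2C eval2Y EY addrC addKr mul_polyC.
  by rewrite scalerA mulVf // scale1r.
- by rewrite eval2B eval2X eval2C Xc subrr.
Qed.

(** In the new coordinates the line is an axis. *)
Lemma rectified_kernel X Y U V p : coordinate_pair U V ->
    eval2 (@polyC F) X Y U = 'X -> eval2 (@polyC F) X Y V = 0 ->
  eval2 (@polyC F) X Y p = 0 -> exists q, p = q * V.
Proof.
move=> [gx [gy [e1 e2 e3 e4]]] eU eV ep.
set p' := subst2 gx gy p.
have pp' : subst2 U V p' = p by rewrite subst2_comp e3 e4 subst2_id.
have [q pq] : exists q, p' = q * 'X.
  have : eval2 (@polyC F) 'X 0 p' = 0.
    by have := eval2_subst2 (@polyC F) X Y U V p'; rewrite eU eV pp' ep.
  have [q [c ->]] : exists q c, p' = q * 'X + c%:P.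
    by elim/poly_ind: (p') => [|q c _]; [exists 0, 0; rewrite mul0r addr0 | exists q, c].
  rewrite eval2D eval2M eval2Y mulr0 add0r eval2P => c0; exists q.
  suff -> : c = 0 by rewrite addr0.
  by rewrite -[c]comp_polyXr; exact: c0.
exists (subst2 U V q); by rewrite -pp' pq subst2M subst2Y.
Qed.

(** Two generators of the same kernel differ by a unit, hence by a constant. *)
Lemma line_coordinate X Y H f : eval2 (@polyC F) X Y H = 'X ->
    (forall p, eval2 (@polyC F) X Y p = 0 <-> exists q, p = q * f) ->
  exists2 U, coordinate_pair U f & eval2 (@polyC F) X Y U = 'X.
Proof.
move=> e ker; have [U [V [UV eU eV]]] := line_rectifiable e.
have [r Vf] := (proj1 (ker V)) eV.
have ef : eval2 (@polyC F) X Y f = 0 by apply/ker; exists 1; rewrite mul1r.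
have [q fV] := rectified_kernel UV eU eV ef.
have V0 : V != 0.
  case: UV => gx [gy [_ e2 _ _]]; apply: contra_eq_neq e2 => ->.
  by rewrite rmorph0 eq_sym polyX_eq0.
have qr : q * r = 1.
  by apply: (mulIf V0); rewrite mul1r [q * r]mulrC -mulrA -fV -Vf.
have [u [w [wq uw]]] : exists u w, q = polyCC w /\ u * w = 1.
  have [q0 [r0 [-> _ qr0]]] := poly_inverse_const qr.
  have [q1 [r1 [-> _ qr1]]] := poly_inverse_const qr0.
  by exists r1, q1; rewrite mulrC.
exists U => //; rewrite fV wq.
have := coordinate_pair_comp UV (coordinate_pair_scale uw); rewrite subst2X subst2M subst2C subst2Y.
by [].
Qed.

End Plane.

(** * Change of coefficients *)
Section CoefficientMaps.
Variables (S S' : comNzRingType) (tau : {rmorphism S -> S'}).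

Definition map2 (p : {poly {poly S}}) : {poly {poly S'}} := map_poly (map_poly tau) p.
HB.instance Definition _ := GRing.RMorphism.copy map2 (map_poly (map_poly tau)).

Lemma map2D p q : map2 (p + q) = map2 p + map2 q. Proof. exact: rmorphD. Qed.
Lemma map2B p q : map2 (p - q) = map2 p - map2 q. Proof. exact: rmorphB. Qed.
Lemma map2M p q : map2 (p * q) = map2 p * map2 q. Proof. exact: rmorphM. Qed.
Lemma map2C c : map2 (polyCC c) = polyCC (tau c).
Proof. by rewrite /map2 /polyCC !map_polyC /= map_polyC. Qed.
Lemma map2X : map2 'X%:P = 'X%:P.
Proof. by rewrite /map2 map_polyC /= map_polyX. Qed.
Lemma map2Y : map2 'X = 'X.
Proof. by rewrite /map2 map_polyX. Qed.

Lemma eval2_map2 (A : comNzRingType) (sigma : {rmorphism S' -> A})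
    (sigma' : {rmorphism S -> A}) a b p :
  (forall c, sigma (tau c) = sigma' c) -> eval2 sigma a b (map2 p) = eval2 sigma' a b p.
Proof.
move=> e; apply: (@bipoly_rmorph_eq S A (eval2 sigma a b \o map2) (eval2 sigma' a b)).
- by move=> c; rewrite /= map2C !eval2C.
- by rewrite /= map2X !eval2X.
- by rewrite /= map2Y !eval2Y.
Qed.

Lemma map2_subst2 g h p : map2 (subst2 g h p) = subst2 (map2 g) (map2 h) (map2 p).
Proof.
apply: (@bipoly_rmorph_eq S {poly {poly S'}} (map2 \o subst2 g h)
  (subst2 (map2 g) (map2 h) \o map2)).
- by move=> c; rewrite /= subst2C !map2C subst2C.
- by rewrite /= map2X !subst2X.
- by rewrite /= map2Y !subst2Y.
Qed.

Lemma map2_eval_map g (c : {poly S}) : map2 (@eval_map S {poly {poly S}} (@polyCC S) g c) =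
  @eval_map S' {poly {poly S'}} (@polyCC S') (map2 g) (map_poly tau c).
Proof.
by rewrite -(subst2P g 'X) map2_subst2 /map2 map_polyC /= -/(map2 _) subst2P.
Qed.

Lemma map_poly_kernel (d : S) (p : {poly S}) : (forall c, tau c = 0 -> exists e, c = d * e) ->
  map_poly tau p = 0 -> exists q, p = d%:P * q.
Proof.
move=> ker; elim/poly_ind: p => [|p c IH]; first by exists 0; rewrite mulr0.
rewrite rmorphD rmorphM /= map_polyX map_polyC /= => e.
have c0 : tau c = 0.
  by have := congr1 (fun h : {poly S'} => h`_0) e; rewrite /= coefD coefMX coefC add0r coef0.
have [|q ->] := IH.
  apply/polyP => i; have := congr1 (fun h : {poly S'} => h`_i.+1) e.
  by rewrite /= coefD coefMX coefC addr0 !coef0.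
have [e' ->] := ker c c0; exists (q * 'X + e'%:P).
by rewrite mulrDr mulrA polyCM.
Qed.

Lemma map_poly_lift : (forall c, exists e, tau e = c) ->
  forall p, exists q, map_poly tau q = p.
Proof.
move=> surj; elim/poly_ind => [|p c [q <-]]; first by exists 0; rewrite rmorph0.
have [e <-] := surj c; exists (q * 'X + e%:P).
by rewrite rmorphD rmorphM /= map_polyX map_polyC.
Qed.
End CoefficientMaps.

Lemma map2_kernel (S S' : comNzRingType) (tau : {rmorphism S -> S'}) (d : S)
    (p : {poly {poly S}}) : (forall c, tau c = 0 -> exists e, c = d * e) ->
  map2 tau p = 0 -> exists q, p = polyCC d * q.
Proof. by move=> ker; apply: map_poly_kernel => c; apply: map_poly_kernel. Qed.

Lemma map2_lift (S S' : comNzRingType) (tau : {rmorphism S -> S'}) :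
  (forall c, exists e, tau e = c) -> forall p, exists q, map2 tau q = p.
Proof. by move=> surj; apply: map_poly_lift; apply: map_poly_lift. Qed.

Lemma coordinate_pair_inj (S : comNzRingType) (g h p : {poly {poly S}}) :
  coordinate_pair g h -> subst2 g h p = 0 -> p = 0.
Proof.
move=> [gx [gy [e1 e2 _ _]]] /(congr1 (subst2 gx gy)).
by rewrite subst2_comp e1 e2 subst2_id rmorph0.
Qed.

(** * From one coordinate fibre to a family of lines *)
Section Fibration.
Variable k : fieldType.
Hypothesis char0 : [pchar k] =i pred0.
Local Notation T := {poly {poly {poly k}}}.
Local Notation B := {poly {poly k}}.
Variables (f : T) (Psi : {rmorphism T -> B}) (a : k) (h : B).
Hypotheses (PsiC : forall c, Psi (polyCC c%:P) = polyCC c)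
  (Psi_surj : forall w, exists W, Psi W = w)
  (Psi_ker : forall W, Psi W = 0 <-> exists q, W = q * f).
Let fiber : T -> B := map2 (horner_eval a).
Hypothesis coord : coordinate_pair (fiber f) h.

Definition cst3 (c : k) : T := polyCC c%:P.
HB.instance Definition _ := GRing.RMorphism.copy cst3 (@polyCC {poly k} \o @polyC k).

Lemma horner_eval_surj (c : k) : exists e, horner_eval a e = c.
Proof. by exists c%:P; rewrite /horner_eval hornerC. Qed.

Lemma fiberC c : fiber (polyCC c) = polyCC c.[a].
Proof. by rewrite /fiber map2C. Qed.

(** The restriction [rho] to the line [f = 0] of the plane [z = a] vanishes on
    [f], so it factors through [Psi] as the evaluation at [(X0, Y0)]. This is a
    line in the plane with ring [B], and its ideal is generated by
    [Psi (z - a)]. *)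
Lemma shifted_parameter_coordinate : exists U : B, coordinate_pair U (Psi (polyCC ('X - a%:P))).
Proof.
have [gx [gy [e1 e2 e3 e4]]] := coord.
pose ev0 : {rmorphism B -> {poly k}} := @eval2 k {poly k} (@polyC k) 0 'X.
have [rho rhoE] : exists rho : {rmorphism T -> {poly k}},
    forall W, rho W = ev0 (subst2 gx gy (fiber W)).
  by exists (ev0 \o (subst2 gx gy \o map2 (horner_eval a))).
have rhoC c : rho (cst3 c) = c%:P.
  by rewrite rhoE fiberC subst2C hornerC; apply: eval2C.
have rhof : rho f = 0 by rewrite rhoE e1; apply: eval2X.
have [Wu hWu] := Psi_surj 'X%:P; have [Wv hWv] := Psi_surj 'X.
have [l lE] : exists l : {rmorphism B -> T}, forall w, l w = @eval2 k T cst3 Wu Wv w.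
  by exists (@eval2 k T cst3 Wu Wv).
have Psil w : Psi (l w) = w.
  apply: (@bipoly_rmorph_eq k B (Psi \o l) idfun) => [c||] /=.
  - by rewrite lE eval2C PsiC.
  - by rewrite lE eval2X hWu.
  - by rewrite lE eval2Y hWv.
pose X0 := rho Wu; pose Y0 := rho Wv.
have rhol w : rho (l w) = eval2 (@polyC k) X0 Y0 w.
  rewrite lE; exact: (@rmorph_eval2 k T {poly k} cst3 rho (@polyC k) Wu Wv w rhoC).
(* W and the lift of Psi W differ by a multiple of f, on which rho vanishes *)
have rhoPsi W : rho W = eval2 (@polyC k) X0 Y0 (Psi W).
  rewrite -rhol; have /Psi_ker[q eq] : Psi (W - l (Psi W)) = 0.
    by rewrite rmorphB Psil subrr.
  by apply/eqP; rewrite -subr_eq0 -rmorphB eq rmorphM rhof mulr0.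
have [Hh eHh] : exists W, fiber W = h.
  exact: map2_lift horner_eval_surj _.
have gen : eval2 (@polyC k) X0 Y0 (Psi Hh) = 'X.
  by rewrite -rhoPsi rhoE eHh e2; apply: eval2Y.
have fz : fiber (polyCC ('X - a%:P)) = 0.
  by rewrite fiberC hornerXsubC subrr; apply: rmorph0.
have [|U UV _] := @line_coordinate k char0 X0 Y0 (Psi Hh) (Psi (polyCC ('X - a%:P))) gen.
  move=> w; split=> [|[q ->]]; last first.
    by rewrite eval2M -rhoPsi rhoE fz !rmorph0 mulr0.
  have [W <-] := Psi_surj w; rewrite -rhoPsi rhoE => w0.
  have [|||q hq] := @rectified_kernel k 0 'X 'X 'X%:P (subst2 gx gy (fiber W)) (coordinate_pair_swap k).
  - exact: eval2Y.
  - exact: eval2X.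
  - exact: w0.
  have eW : fiber W = subst2 (fiber f) h q * fiber f.
    by rewrite -[LHS]subst2_id -e3 -e4 -subst2_comp hq subst2M subst2X.
  have [s es] : exists s, fiber s = subst2 (fiber f) h q.
    exact: map2_lift horner_eval_surj _.
  have [||q' hq'] := @map2_kernel {poly k} k (horner_eval a) ('X - a%:P) (W - s * f).
  - move=> c /eqP; rewrite -[_ == 0]/(root c a) => /factor_theorem[c' ->].
    by exists c'; rewrite mulrC.
  - by rewrite map2B map2M -!/(fiber _) es eW subrr.
  exists (Psi q'); rewrite -(subrK (s * f) W) hq' rmorphD !rmorphM /=.
  have -> : Psi f = 0 by apply/Psi_ker; exists 1; rewrite mul1r.
  by rewrite mulr0 addr0 mulrC.
by exists U.
Qed.

(** Once [z - a] is one of two coordinates on [B], the other one makes [B] a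
    polynomial ring over [k[z]], and [Psi] is [k[z]]-linear. *)
Lemma family_of_lines : exists (X Y : {poly {poly k}}) (H : T),
  eval2 (@polyC {poly k}) X Y H = 'X /\
  forall p, eval2 (@polyC {poly k}) X Y p = 0 <-> exists q, p = q * f.
Proof.
have [U UV] := shifted_parameter_coordinate.
have [gx [gy [e1 e2 e3 e4]]] := UV.
(* z is p + a for the coordinate p = Psi (z - a) *)
have shift : coordinate_pair 'X ('X%:P - polyCC a).
  exists ('X + polyCC a), 'X%:P.
  by rewrite subst2B subst2D !subst2X !subst2Y !subst2C addrK subrK.
have [theta thetaE] : exists theta : {rmorphism B -> B},
    forall w, theta w = subst2 'X ('X%:P - polyCC a) (subst2 gx gy w).
  by exists (subst2 'X ('X%:P - polyCC a) \o subst2 gx gy).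
have theta_inj w : theta w = 0 -> w = 0.
  rewrite thetaE => /(coordinate_pair_inj shift)/(congr1 (subst2 U (Psi (polyCC ('X - a%:P))))).
  by rewrite subst2_comp e3 e4 subst2_id rmorph0.
have [Th ThPsi] : exists Th : {rmorphism T -> B}, forall W, Th W = theta (Psi W).
  by exists (theta \o Psi).
have Thc c : Th (polyCC c%:P) = polyCC c by rewrite ThPsi PsiC thetaE !subst2C.
have ThX : Th (polyCC 'X) = 'X%:P.
  have -> : polyCC 'X = polyCC ('X - a%:P) + polyCC a%:P :> T.
    by rewrite /polyCC -!polyCD subrK.
  by rewrite rmorphD Thc ThPsi thetaE e2 subst2Y subrK.
have ThC c : Th (polyCC c) = c%:P.
  elim/poly_ind: c => [|c d IH]; first by rewrite !rmorph0.
  have -> : polyCC (c * 'X + d%:P) = polyCC c * polyCC 'X + polyCC d%:P :> T.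
    by rewrite /polyCC -!polyCM -!polyCD.
  by rewrite rmorphD rmorphM IH ThX Thc /polyCC -polyCM -polyCD.
exists (Th 'X%:P), (Th 'X).
have ThE p : eval2 (@polyC {poly k}) (Th 'X%:P) (Th 'X) p = Th p.
  apply: (@bipoly_rmorph_eq {poly k} B (eval2 (@polyC {poly k}) (Th 'X%:P) (Th 'X)) Th).
  - by move=> c; rewrite ThC; exact: eval2C.
  - exact: eval2X.
  - exact: eval2Y.
have [W hW] := Psi_surj U.
exists W; split.
  by rewrite ThE ThPsi hW thetaE e1 subst2X.
move=> p; rewrite ThE -Psi_ker ThPsi; split; first exact: theta_inj.
by move=> ->; rewrite rmorph0.
Qed.
End Fibration.

(** * Algebraic dependence on a special fibre *)
Lemma residue_field (k : fieldType) (r : {poly k}) : (1 < size r)%N ->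
  exists (kappa : fieldType) (psi : {rmorphism {poly k} -> kappa}) (q : {poly k}),
    [/\ (1 < size q)%N, psi r = 0, forall c, exists e, psi e = c &
        forall c, psi c = 0 <-> exists e, c = q * e].
Proof.
move=> r1.
have [q [qi qm qr]] : exists q : {poly k}, [/\ irreducible_poly q, q \is monic & q %| r].
  have [m] := ubnP (size r); elim: m r r1 => // m IH r r1 rm.
  have [ri|nri] := pselect (irreducible_poly r).
    have lr : lead_coef r != 0 by rewrite lead_coef_eq0 -size_poly_gt0 ltnW.
    exists ((lead_coef r)^-1 *: r); split.
    - split=> [|q qs qd]; first by rewrite size_scale ?invr_eq0.
      case: ri => _ ri; apply: eqp_trans (ri q qs _) _.
        by move: qd; rewrite dvdpZr ?invr_eq0.
      by rewrite eqp_sym eqp_scale ?invr_eq0.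
    - by rewrite monicE lead_coefZ mulVf.
    - by rewrite dvdpZl ?invr_eq0.
  have [q qs [qr nq]] : exists2 q : {poly k}, size q != 1%N & q %| r /\ ~~ (q %= r).
    apply: contrapT => H; apply: nri; split=> // q qs qr.
    by apply/negPn/negP => nq; apply: H; exists q.
  have r0 : r != 0 by rewrite -size_poly_gt0 ltnW.
  have q0 : q != 0 by apply: contraTneq qr => ->; rewrite dvd0p.
  have sqr : (size q < size r)%N.
    by rewrite ltn_neqAle dvdp_leq // andbT; apply: contra nq; rewrite -dvdp_size_eqp.
  have q1 : (1 < size q)%N by move: q0; rewrite -size_poly_gt0; case: (size q) qs => [|[]].
  have [q' [qi qm qd]] := IH q q1 (leq_trans sqr rm).
  by exists q'; split=> //; apply: dvdp_trans qd qr.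
have hI : monic_irreducible_poly q by split.
pose kappa : fieldType := {poly %/ q with hI}.
have qs : (1 < size q)%N by case: qi.
have mq : mk_monic q = q by apply: mk_monicE.
pose psi : {rmorphism {poly k} -> kappa} := in_qpoly q.
have psi0 c : psi c = 0 <-> exists e, c = q * e.
  have vE : val (psi c) = Pdiv.Ring.rmodp c q by rewrite /= mq.
  split=> [e|[e ->]].
    have /(Pdiv.RingMonic.rdvdpP qm)[e' ->] : Pdiv.Ring.rdvdp q c.
      by apply/eqP; rewrite -vE e.
    by exists e'; rewrite mulrC.
  apply: val_inj; rewrite /= mq mulrC; exact: Pdiv.RingMonic.rmodp_mull.
exists kappa, psi, q; split=> //.
  by apply/psi0; have /dvdpP[e ->] := qr; exists e; rewrite mulrC.
move=> c; exists (val (c : {poly %/ q})); apply: val_inj.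
by have := @in_qpoly_small _ q _ (size_mk_monic (c : {poly %/ q})).
Qed.

Section IndependenceDomain.
Variable (D : idomainType) (X Y : {poly D}) (f h : {poly {poly D}}).
Local Notation Psi := (eval2 (@polyC D) X Y).
Hypotheses (f0 : f != 0) (Pf : Psi f = 0) (Ph : (1 < size (Psi h))%N).

(** Applying [Psi] to a relation leaves its constant term in [f], evaluated at the
    nonconstant polynomial [Psi h]; so this term is zero and [f] can be cancelled. *)
Lemma independent_swapped G : subst2 h f G = 0 -> G = 0.
Proof.
elim/poly_ind: G => [//|q c IH].
rewrite subst2D subst2M subst2Y => e.
have c0 : c = 0.
  have := congr1 Psi e; rewrite rmorph0 eval2D eval2M Pf mulr0 add0r eval2_subst2 eval2P.
  move=> /eqP; rewrite -[eval_map _ _ _]/(c \Po Psi h) comp_poly_eq0 //.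
  by move/eqP.
move: e; rewrite c0 rmorph0 addr0 => /eqP; rewrite mulf_eq0 (negbTE f0) orbF => /eqP/IH->.
by rewrite mul0r add0r.
Qed.

Lemma independent G : subst2 f h G = 0 -> G = 0.
Proof.
move=> e; apply: (coordinate_pair_inj (coordinate_pair_swap D)); apply: independent_swapped.
by rewrite subst2_comp subst2X subst2Y.
Qed.
End IndependenceDomain.

Section Dependence.
Variables (K : fieldType) (X Y : {poly K}) (f : {poly {poly K}}).
Local Notation Psi := (eval2 (@polyC K) X Y).
Hypotheses (ker : forall p, Psi p = 0 <-> exists q, p = q * f) (f0 : f != 0).

(** The degree of a leading monomial, which makes it additive on products. *)
Definition bidegree (p : {poly {poly K}}) := ((size p).-1 + (size (lead_coef p)).-1)%N.

Lemma bidegreeM p q : p != 0 -> q != 0 -> bidegree (p * q) = (bidegree p + bidegree q)%N.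
Proof.
move=> p0 q0; rewrite /bidegree lead_coefM !size_mul ?lead_coef_eq0 //.
have lp : lead_coef p != 0 by rewrite lead_coef_eq0.
have lq : lead_coef q != 0 by rewrite lead_coef_eq0.
move: p0 q0 lp lq; rewrite -!size_poly_gt0.
by move: (size p) (size q) (size (lead_coef p)) (size (lead_coef q)) => x y z t; clear; lia.
Qed.

Lemma bidegree0 p : bidegree p = 0%N -> exists c, p = polyCC c.
Proof.
rewrite /bidegree => /eqP; rewrite addn_eq0 => /andP[p0 l0].
have ps : (size p <= 1)%N by case: (size p) p0 => [|[]].
have [d pd] : exists d, p = d%:P by exists p`_0; apply: size1_polyC.
move: l0; rewrite pd lead_coefC => l0; exists d`_0.
by rewrite /polyCC -size1_polyC //; case: (size d) l0 => [|[]].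
Qed.

Lemma bidegreeD p c : bidegree p != 0%N -> bidegree (p + polyCC c) = bidegree p.
Proof.
move=> pn; case: (leqP (size p) 1) => ps.
  have [d pd] : exists d, p = d%:P by exists p`_0; apply: size1_polyC.
  move: pn; rewrite pd /polyCC -polyCD /bidegree !lead_coefC !size_polyC => pn.
  have ds : (1 < size d)%N by move: pn; case: (size d) => [|[|m]] //; case: (d != 0).
  have d0 : d != 0 by rewrite -size_poly_gt0 ltnW.
  have sd : size (d + c%:P) = size d.
    by rewrite size_polyDl // (leq_ltn_trans (size_polyC_leq1 _)).
  have d1 : d + c%:P != 0 by rewrite -size_poly_gt0 sd size_poly_gt0.
  by rewrite sd d0 d1.
have cs : (size (polyCC c) < size p)%N.
  by apply: leq_ltn_trans ps; apply: size_polyC_leq1.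
by rewrite /bidegree size_polyDl // lead_coefDl.
Qed.

(** By [independent], [Psi h] is a constant [b], so [h - b] is a multiple [h2 * f].
    The factor [h2] also depends algebraically on [f] and has smaller bidegree
    than [h]. *)
Lemma dependent_in_pencil h G : G != 0 -> subst2 f h G = 0 ->
  exists c : {poly K}, h = @eval_map K {poly {poly K}} (@polyCC K) f c.
Proof.
have [m] := ubnP (bidegree h); elim: m h G => // m IH h G hm G0 eG.
have [h0|hn] := eqVneq (bidegree h) 0%N.
  by have [c ->] := bidegree0 h0; exists c%:P; rewrite eval_mapC.
have Pf : Psi f = 0 by apply/ker; exists 1; rewrite mul1r.
case: (leqP (size (Psi h)) 1) => Ph; last first.
  by move: G0; rewrite (independent f0 Pf Ph eG) eqxx.
set b := (Psi h)`_0.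
have [h2 eh2] : exists q, h - polyCC b = q * f.
  by apply/ker; rewrite eval2B eval2C [Psi h]size1_polyC // subrr.
have fn : bidegree f != 0%N.
  apply: contra_neqN f0 => /eqP /bidegree0[c fc]; move: Pf; rewrite fc eval2C => /eqP.
  by rewrite polyC_eq0 => /eqP->; rewrite /polyCC.
have hE : h = polyCC b + 'X%:P * 0 + h2 * f by rewrite mulr0 addr0 -eh2 addrC subrK.
rewrite mulr0 addr0 in hE.
have [h20|h20] := eqVneq h2 0.
  exists b%:P; rewrite eval_mapC hE h20 mul0r addr0 //.
have hm2 : (bidegree h2 < m)%N.
  have e : bidegree (h2 * f) = bidegree h.
    have n0 : bidegree (h2 * f) != 0%N by rewrite bidegreeM // addn_eq0 negb_and fn orbT.
    by rewrite [in RHS]hE addrC bidegreeD.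
  by move: hm fn; rewrite -e bidegreeM //; move: (bidegree _) (bidegree _) => x y; clear; lia.
(* a relation between f and h2 from the one between f and h = b + h2 * f *)
pose G' := subst2 'X%:P (polyCC b + 'X * 'X%:P) G.
have eG' : subst2 f h2 G' = 0.
  by rewrite /G' subst2_comp subst2X subst2D subst2M subst2C subst2Y subst2X -hE.
have G'0 : G' != 0.
  have -> : G' = G \Po (polyCC b + 'X * 'X%:P).
    apply: (@bipoly_rmorph_eq K {poly {poly K}} (subst2 'X%:P (polyCC b + 'X * 'X%:P))
      (comp_poly (polyCC b + 'X * 'X%:P))).
    - by move=> c; rewrite /= subst2C comp_polyC.
    - by rewrite /= subst2X comp_polyC.
    - by rewrite /= subst2Y comp_polyX.
  rewrite comp_poly2_eq0 // addrC mulrC size_MXaddC polyC_eq0 polyX_eq0 /=.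
  by rewrite size_polyC polyX_eq0.
have [c ec] := IH h2 G' hm2 G'0 eG'; exists (b%:P + c * 'X).
by rewrite eval_mapD eval_mapM eval_mapC eval_mapX -ec.
Qed.
End Dependence.

(** * From the generic coordinate to a coordinate *)
Lemma tofrac_inj (R : idomainType) : injective (@FracField.tofrac R).
Proof. by move=> x y /eqP; rewrite tofrac_eq => /eqP. Qed.

Lemma map2_inj (S S' : comNzRingType) (tau : {rmorphism S -> S'}) :
  injective tau -> injective (map2 tau).
Proof.
move=> inj p q e; apply/polyP => i; apply/polyP => j; apply: inj.
by have := congr1 (fun u : {poly {poly S'}} => u`_i`_j) e; rewrite /= /map2 !coef_map.
Qed.

Lemma polyCCM (S : comNzRingType) (a b : S) : polyCC (a * b) = polyCC a * polyCC b.
Proof. by rewrite /polyCC !polyCM. Qed.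

Lemma common_denominator2 (R : idomainType) (p : {poly {poly {fraction R}}}) :
  exists (s : R) (p' : {poly {poly R}}), s != 0 /\ polyCC s%:F * p = map2 tofrac p'.
Proof.
elim/poly_ind: p => [|p c [s [p' [s0 e]]]].
  by exists 1, 0; rewrite oner_neq0 mulr0 rmorph0.
have [t [c' [t0 e']]] := common_denominator c.
exists (s * t), (polyCC t * p' * 'X + (s%:P * c')%:P); split; first by rewrite mulf_neq0.
rewrite map2D 2!map2M map2C map2Y.
rewrite -e.
have -> : map2 tofrac (s%:P * c')%:P = polyCC s%:F * (t%:F *: c)%:P.
  rewrite /map2 map_polyC /= rmorphM /= map_polyC /= -e'.
  by rewrite polyCM.
rewrite -mul_polyC polyCM.
rewrite -/(polyCC t%:F).
rewrite tofracM polyCCM.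
move: (polyCC s%:F) (polyCC t%:F) => x y.
rewrite mulrDr mulrA mulrA.
rewrite [y * x]mulrC mulrA.
by [].
Qed.

Lemma pchar_fraction (k : fieldType) : [pchar k] =i pred0 ->
  [pchar {fraction {poly k}}] =i pred0.
Proof.
move=> /pcharf0P c0; apply/pcharf0P => n.
rewrite -tofrac1 -rmorphMn /= tofrac_eq0 -polyC1 -polyCMn polyC_eq0; exact: c0.
Qed.

Lemma polyCC_neq0 (R : idomainType) (c : R) : c != 0 -> polyCC c != 0 :> {poly {poly R}}.
Proof. by move=> c0; rewrite /polyCC !polyC_eq0. Qed.

Lemma subst2_cancel (R : idomainType) (q r : R) (f h G e : {poly {poly R}}) : q != 0 ->
  subst2 f h (polyCC q * G) = polyCC (q * r) * e -> subst2 f h G = polyCC r * e.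
Proof.
by move=> q0; rewrite subst2M subst2C polyCCM -mulrA => /(mulfI (polyCC_neq0 q0)).
Qed.

Lemma subst2_unscale (R : idomainType) (u r : R) (f h G e : {poly {poly R}}) : u * r = 1 ->
  subst2 f h G = polyCC r * e -> subst2 f h (polyCC u * G) = e.
Proof.
move=> ur eG; rewrite subst2M subst2C eG mulrA -polyCCM ur.
exact: mul1r.
Qed.

Section Family.
Variable R : idomainType.
Local Notation K := {fraction R}.
Variables (X Y : {poly R}) (H f : {poly {poly R}}).
Local Notation Psi := (eval2 (@polyC R) X Y).
Hypotheses (gen : Psi H = 'X) (ker : forall p, Psi p = 0 <-> exists q, p = q * f).

Lemma Psi_onto w : exists W, Psi W = w.
Proof.
exists (@eval_map R {poly {poly R}} (@polyCC R) H w).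
rewrite (@rmorph_eval_map R {poly {poly R}} {poly R} (@polyCC R) Psi (@polyC R)) => [|c].
  by rewrite /= gen -[RHS]comp_polyXr.
exact: eval2C.
Qed.

Lemma Psi_f : Psi f = 0.
Proof. by apply/ker; exists 1; rewrite mul1r. Qed.

Section GenericFiber.
Hypothesis charK : [pchar {fraction R}] =i pred0.
Let fK := map2 (@FracField.tofrac R) f.
Let XK := map_poly (@FracField.tofrac R) X.
Let YK := map_poly (@FracField.tofrac R) Y.

Lemma PsiK_map p : eval2 (@polyC K) XK YK (map2 tofrac p) = map_poly tofrac (Psi p).
Proof.
pose tau : {rmorphism R -> {poly K}} := @polyC K \o @FracField.tofrac R.
rewrite (@eval2_map2 R K (@FracField.tofrac R) {poly K} (@polyC K) tau) //.
rewrite (@rmorph_eval2 R {poly R} {poly K} (@polyC R) (map_poly (@FracField.tofrac R)) tau) //.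
by move=> c; rewrite /= map_polyC.
Qed.

Lemma kerK p : eval2 (@polyC K) XK YK p = 0 <-> exists q, p = q * fK.
Proof.
split=> [p0|[q ->]]; last by rewrite eval2M PsiK_map Psi_f rmorph0 mulr0.
have [s [p' [s0 e]]] := common_denominator2 p.
have s0F : s%:F != 0 :> K by rewrite tofrac_eq0.
have /ker[q eq] : Psi p' = 0.
  have inj := map_inj_poly (@tofrac_inj R) (rmorph0 _).
  by apply: inj; rewrite -PsiK_map -e eval2M p0 mulr0 rmorph0.
exists (polyCC (s%:F)^-1 * map2 tofrac q).
rewrite -mulrA -map2M -eq -e mulrA -polyCCM mulVf //.
by rewrite /polyCC !polyC1 mul1r.
Qed.

(** The mate of [f] over the fraction field, after clearing denominators. *)
Lemma generic_coordinate : exists (h : {poly {poly R}}) (r : R) (Gx Gy : {poly {poly R}}),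
  [/\ f != 0, size (Psi h) = 2%N, r != 0,
      subst2 f h Gx = polyCC r * 'X%:P & subst2 f h Gy = polyCC r * 'X].
Proof.
have genK : eval2 (@polyC K) XK YK (map2 tofrac H) = 'X.
  by rewrite PsiK_map gen map_polyX.
have [U UV eU] := line_coordinate charK genK kerK.
have f0 : f != 0.
  case: UV => gx [gy [_ e2 _ _]]; apply: contra_eq_neq e2 => f0.
  by rewrite /fK f0 !rmorph0 eq_sym polyX_eq0.
have [s [h [s0 eh]]] := common_denominator2 U.
have s0F : s%:F != 0 :> K by rewrite tofrac_eq0.
have sh : size (Psi h) = 2%N.
  rewrite -(size_map_inj_poly (@tofrac_inj R) (rmorph0 _)) -PsiK_map -eh eval2M eval2C eU.
  by rewrite mul_polyC size_scale // size_polyX.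
have clear (g : {poly {poly K}}) (e : {poly {poly R}}) : subst2 U fK g = map2 tofrac e ->
    exists (t : R) (G : {poly {poly R}}), t != 0 /\ subst2 f h G = polyCC t * e.
  move=> eg; pose G0 := subst2 (polyCC (s%:F)^-1 * 'X) 'X%:P g.
  have eG0 : subst2 fK (map2 tofrac h) G0 = map2 tofrac e.
    rewrite /G0 subst2_comp subst2M subst2C subst2Y subst2X -eh mulrA -polyCCM mulVf //.
    by rewrite /polyCC !polyC1 mul1r.
  have [t [G [t0 eG]]] := common_denominator2 G0.
  exists t, G; split=> //; apply: (map2_inj (@tofrac_inj R)).
  by rewrite map2_subst2 -eG subst2M subst2C eG0 map2M map2C.
have [gx [gy [_ _ e3 e4]]] := UV.
have [|t1 [Gx [t10 eGx]]] := clear gx 'X%:P; first by rewrite map2X.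
have [|t2 [Gy [t20 eGy]]] := clear gy 'X; first by rewrite map2Y.
exists h, (t1 * t2), (polyCC t2 * Gx), (polyCC t1 * Gy); split.
- exact: f0.
- exact: sh.
- by rewrite mulf_neq0.
- by rewrite subst2M subst2C eGx mulrA -(polyCCM t2 t1) (mulrC t2 t1).
- by rewrite subst2M subst2C eGy mulrA -(polyCCM t1 t2).
Qed.

End GenericFiber.

Section SpecialFiber.
Hypothesis f0 : f != 0.
Variables (kappa : fieldType) (psi : {rmorphism R -> kappa}) (q : R).
Hypotheses (q0 : q != 0) (qN1 : forall e, q * e != 1) (psi_surj : forall c, exists e, psi e = c)
  (psi_ker : forall c, psi c = 0 <-> exists e, c = q * e).

Let psi_ker1 c : psi c = 0 -> exists e, c = q * e. Proof. by move/psi_ker. Qed.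

Let fbar := map2 psi f.
Let Xbar := map_poly psi X.
Let Ybar := map_poly psi Y.

Lemma Psibar_map p : eval2 (@polyC kappa) Xbar Ybar (map2 psi p) = map_poly psi (Psi p).
Proof.
pose tau : {rmorphism R -> {poly kappa}} := @polyC kappa \o psi.
rewrite (@eval2_map2 R kappa psi {poly kappa} (@polyC kappa) tau) //.
rewrite (@rmorph_eval2 R {poly R} {poly kappa} (@polyC R) (map_poly psi) tau) //.
by move=> c; rewrite /= map_polyC.
Qed.

Lemma kerbar p : eval2 (@polyC kappa) Xbar Ybar p = 0 <-> exists e, p = e * fbar.
Proof.
split=> [|[e ->]]; last by rewrite eval2M Psibar_map Psi_f rmorph0 mulr0.
have [p' <-] := map2_lift psi_surj p; rewrite Psibar_map.
move=> /(map_poly_kernel psi_ker1)[w ew].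
have [W eW] := Psi_onto w.
have /ker[e ee] : Psi (p' - polyCC q * W) = 0.
  by rewrite eval2B eval2M eval2C eW ew subrr.
exists (map2 psi e); rewrite -map2M -ee map2B map2M map2C.
have -> : psi q = 0 by apply/psi_ker; exists 1; rewrite mulr1.
by rewrite /polyCC !polyC0 mul0r subr0.
Qed.

(** If [q] divided [f], the quotient would be in the kernel of [Psi] too, that is, a
    multiple of [f]. *)
Lemma fbar_neq0 : fbar != 0.
Proof.
apply/eqP => /(map2_kernel psi_ker1)[f1 ef].
have /ker[s es] : Psi f1 = 0.
  apply/eqP; have := Psi_f; rewrite ef eval2M eval2C => /eqP.
  by rewrite mulf_eq0 polyC_eq0 (negbTE q0).
have : polyCC q * s = 1.
  by apply: (mulIf f0); rewrite mul1r -mulrA -es -ef.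
case/poly_inverse_const => a [b [/polyC_inj <- _ ab]].
have [c [d [/polyC_inj <- _ /eqP]]] := poly_inverse_const ab.
by rewrite (negbTE (qN1 _)).
Qed.

Lemma dependent_descent (h G : {poly {poly R}}) : map2 psi G != 0 -> map2 psi (subst2 f h G) = 0 ->
  exists (c : {poly R}) (h1 : {poly {poly R}}), h = @eval_map R {poly {poly R}} (@polyCC R) f c + polyCC q * h1.
Proof.
move=> G0 eG; rewrite map2_subst2 in eG.
have [c ec] := dependent_in_pencil kerbar fbar_neq0 G0 eG.
have [c' ec'] := map_poly_lift psi_surj c.
exists c'; have [|h1 eh] := @map2_kernel _ _ psi q
    (h - @eval_map R {poly {poly R}} (@polyCC R) f c') psi_ker1; last first.
  by exists h1; rewrite -eh addrC subrK.
apply/eqP; rewrite map2B subr_eq0 ec -ec'; apply/eqP.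
by rewrite map2_eval_map.
Qed.

Lemma descent_psi (h : {poly {poly R}}) (c : {poly R}) (h1 : {poly {poly R}}) : size (Psi h) = 2%N ->
    h = @eval_map R {poly {poly R}} (@polyCC R) f c + polyCC q * h1 ->
  size (Psi h1) = 2%N /\ (Psi h)`_1 = q * (Psi h1)`_1.
Proof.
move=> sh eh.
have e : Psi h = c.[0]%:P + q%:P * Psi h1.
  rewrite eh eval2D eval2M eval2C; congr (_ + _).
  rewrite (@rmorph_eval_map R {poly {poly R}} {poly R} (@polyCC R) Psi (@polyC R)) => [|d].
    by rewrite /= Psi_f -[LHS]/(c \Po 0) comp_poly0r horner_coef0.
  exact: eval2C.
have j1 : (Psi h)`_1 = q * (Psi h1)`_1 by rewrite e coefD coefC add0r coefCM.
have j0 : (Psi h)`_1 != 0 by rewrite -[1%N]/(2.-1) -sh -lead_coefE lead_coef_eq0 -size_poly_gt0 sh.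
have j10 : (Psi h1)`_1 != 0 by apply: contra_neq j0 => z; rewrite j1 z mulr0.
split=> //; apply/eqP; rewrite eqn_leq; apply/andP; split; last first.
  by rewrite ltnNge; apply: contra j10 => z; rewrite nth_default.
apply/leq_sizeP => i i2; have := congr1 (fun p : {poly R} => p`_i) e.
rewrite /= coefD coefC coefCM nth_default ?sh //.
by case: i i2 => [|i] //= _ /esym/eqP; rewrite add0r mulf_eq0 (negbTE q0) => /eqP.
Qed.
End SpecialFiber.
End Family.

Section Descent.
Variable k : fieldType.
Hypothesis char0 : [pchar k] =i pred0.
Local Notation R := {poly k}.
Variables (X Y : {poly R}) (H f : {poly {poly R}}).
Local Notation Psi := (eval2 (@polyC R) X Y).
Hypotheses (gen : Psi H = 'X) (ker : forall p, Psi p = 0 <-> exists q, p = q * f).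

(** The sum of the degrees of the denominator [r] and of the coefficient of [w] in
    [Psi h] decreases: a prime factor of [r] is cancelled, or it is divided out
    of [h - c(f)]. *)
Lemma descent (h : {poly {poly R}}) (r : R) (Gx Gy : {poly {poly R}}) : f != 0 -> size (Psi h) = 2%N -> r != 0 ->
    subst2 f h Gx = polyCC r * 'X%:P -> subst2 f h Gy = polyCC r * 'X ->
  exists h' gx gy : {poly {poly R}}, [/\ size (Psi h') = 2%N, subst2 f h' gx = 'X%:P & subst2 f h' gy = 'X].
Proof.
move=> f0; have [m] := ubnP (size r + size (Psi h)`_1).
elim: m h r Gx Gy => // m IH h r Gx Gy hm sh r0 eGx eGy.
have [r1|r1] := leqP (size r) 1.
  have [c rc] : exists c, r = c%:P by exists r`_0; apply: size1_polyC.
  have c0 : c != 0 by move: r0; rewrite rc polyC_eq0.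
  have inv : (c^-1)%:P * r = 1 by rewrite rc -polyCM mulVf.
  exists h, (polyCC (c^-1)%:P * Gx), (polyCC (c^-1)%:P * Gy).
  by split; [exact: sh | exact: subst2_unscale inv eGx | exact: subst2_unscale inv eGy].
have [kappa [psi [q [q1 psir psi_surj psi_ker]]]] := residue_field r1.
have q0 : q != 0 by rewrite -size_poly_gt0 ltnW.
have qN1 e : q * e != 1.
  apply/eqP => /poly_inverse_const[c [_ [qc _ _]]].
  by move: q1; rewrite qc size_polyC; case: (c != 0).
have step G e : subst2 f h G = polyCC r * e -> map2 psi G != 0 ->
    exists h' gx gy : {poly {poly R}}, [/\ size (Psi h') = 2%N, subst2 f h' gx = 'X%:P & subst2 f h' gy = 'X].
  move=> eG G0.
  have [|c [h1 eh]] := dependent_descent gen ker f0 q0 qN1 psi_surj psi_ker G0 (h := h).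
    by rewrite eG map2M map2C psir /polyCC !polyC0 mul0r.
  have [sh1 j1] := descent_psi ker q0 sh eh.
  have j10 : (Psi h1)`_1 != 0.
    by rewrite -[1%N]/(2.-1) -sh1 -lead_coefE lead_coef_eq0 -size_poly_gt0 sh1.
  have lt1 : (size ((Psi h1)`_1)%R < size ((Psi h)`_1)%R)%N.
    rewrite j1 size_mul //; move: j10 q1; rewrite -size_poly_gt0.
    by move: (size _) (size q) => x y; clear; lia.
  pose T := @eval_map R {poly {poly R}} (@polyCC R) 'X%:P c + polyCC q * 'X.
  have eT : subst2 f h1 T = h.
    rewrite eh /T subst2D subst2M subst2C subst2Y; congr (_ + _).
    by rewrite eval_map_polyCC_X subst2P.
  have pull g : subst2 f h1 (subst2 'X%:P T g) = subst2 f h g.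
    by rewrite subst2_comp subst2X eT.
  apply: (IH h1 r (subst2 'X%:P T Gx) (subst2 'X%:P T Gy)) => //.
  - by rewrite ltnS in hm; apply: leq_trans hm; rewrite ltn_add2l.
  - by rewrite pull.
  - by rewrite pull.
have [Gx0|] := eqVneq (map2 psi Gx) 0; last exact: step eGx.
have [Gy0|] := eqVneq (map2 psi Gy) 0; last exact: step eGy.
have psi_ker1 c : psi c = 0 -> exists e, c = q * e by move/psi_ker.
have [Gx1 eGx1] := map2_kernel psi_ker1 Gx0.
have [Gy1 eGy1] := map2_kernel psi_ker1 Gy0.
have [r' er] := psi_ker1 r psir.
have r'0 : r' != 0 by apply: contra_neq r0 => z; rewrite er z mulr0.
have cancel G1 e : subst2 f h (polyCC q * G1) = polyCC r * e ->
    subst2 f h G1 = polyCC r' * e.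
  by rewrite er => /(subst2_cancel q0).
have Gx1E : subst2 f h Gx1 = polyCC r' * 'X%:P by apply: cancel; rewrite -eGx1.
have Gy1E : subst2 f h Gy1 = polyCC r' * 'X by apply: cancel; rewrite -eGy1.
have r'm : (size r' + size ((Psi h)`_1)%R < m)%N.
  rewrite ltnS in hm; apply: leq_trans hm; rewrite ltn_add2r er size_mul //.
  move: r'0 q1; rewrite -size_poly_gt0.
  by move: (size r') (size q) => x y; clear; lia.
exact: IH r'm sh r'0 Gx1E Gy1E.
Qed.

(** Algebraic independence of [f] and [h'] makes the one-sided inverse two-sided. *)
Lemma family_coordinate : exists h : {poly {poly R}}, coordinate_pair f h.
Proof.
have [h [r [Gx [Gy [f0 sh r0 eGx eGy]]]]] := generic_coordinate gen ker (pchar_fraction char0).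
have [h' [gx [gy [sh' egx egy]]]] := descent f0 sh r0 eGx eGy.
have inj p p' : subst2 f h' p = subst2 f h' p' -> p = p'.
  move=> e; apply/eqP; rewrite -subr_eq0; apply/eqP.
  apply: (@independent _ X Y f h' f0 (Psi_f ker)); first by rewrite sh'.
  by rewrite subst2B e subrr.
exists h', gx, gy; split=> //; apply: inj; rewrite subst2_comp egx egy subst2_id.
  by rewrite subst2X.
by rewrite subst2Y.
Qed.
End Descent.

(** * Multivariate and iterated polynomials *)
Lemma mpoly_rmorph_eq (n : nat) (S A : comNzRingType) (r1 r2 : {rmorphism {mpoly S[n]} -> A}) :
  (forall c, r1 c%:MP = r2 c%:MP) -> (forall i, r1 'X_i = r2 'X_i) -> r1 =1 r2.
Proof.
move=> eC eX p; rewrite [p]mpolyE !rmorph_sum; apply: eq_bigr => m _.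
rewrite -mul_mpolyC !rmorphM eC; congr (_ * _).
rewrite mpolyXE_id !rmorph_prod; apply: eq_bigr => i _.
by rewrite !rmorphXn eX.
Qed.

Section TwoVariables.
Variable S : comNzRingType.
Local Notation MP := {mpoly S[2]}.
Local Notation BP := {poly {poly S}}.

Definition bipoly_of : MP -> BP := mmap (@polyCC S) (tnth [tuple 'X%:P; 'X]).
HB.instance Definition _ := GRing.RMorphism.copy bipoly_of (mmap (@polyCC S) (tnth [tuple 'X%:P; 'X])).
Definition mpoly_of_bipoly : BP -> MP := @eval2 S MP (@mpolyC 2 S) 'X_ord0 'X_ord_max.
HB.instance Definition _ := GRing.RMorphism.copy mpoly_of_bipoly (@eval2 S MP (@mpolyC 2 S) 'X_ord0 'X_ord_max).

Lemma bipoly_ofC c : bipoly_of c%:MP = polyCC c. Proof. by rewrite /bipoly_of mmapC. Qed.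
Lemma bipoly_ofX : bipoly_of 'X_ord0 = 'X%:P.
Proof. by rewrite /bipoly_of mmapX mmap1U. Qed.
Lemma bipoly_ofY : bipoly_of 'X_ord_max = 'X.
Proof. by rewrite /bipoly_of mmapX mmap1U. Qed.

Lemma ord2P (P : 'I_2 -> Prop) : P ord0 -> P ord_max -> forall i, P i.
Proof.
move=> P0 P1 [[|[|//]] h].
  by rewrite (_ : Ordinal h = ord0) //; apply: val_inj.
by rewrite (_ : Ordinal h = ord_max) //; apply: val_inj.
Qed.

Lemma mpoly_of_bipolyK p : bipoly_of (mpoly_of_bipoly p) = p.
Proof.
apply: (@bipoly_rmorph_eq S BP (bipoly_of \o mpoly_of_bipoly) idfun) => [c||] /=.
- by rewrite /mpoly_of_bipoly eval2C bipoly_ofC.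
- by rewrite /mpoly_of_bipoly eval2X bipoly_ofX.
- by rewrite /mpoly_of_bipoly eval2Y bipoly_ofY.
Qed.

Lemma bipoly_ofK p : mpoly_of_bipoly (bipoly_of p) = p.
Proof.
apply: (@mpoly_rmorph_eq 2 S MP (mpoly_of_bipoly \o bipoly_of) idfun) => [c|] /=.
  by rewrite bipoly_ofC /mpoly_of_bipoly eval2C.
by apply: ord2P; rewrite ?bipoly_ofX ?bipoly_ofY /mpoly_of_bipoly ?eval2X ?eval2Y.
Qed.

Lemma bipoly_of_comp g h p :
  bipoly_of (p \mPo [tuple g; h]) = subst2 (bipoly_of g) (bipoly_of h) (bipoly_of p).
Proof.
apply: (@mpoly_rmorph_eq 2 S BP (bipoly_of \o comp_mpoly [tuple g; h])
  (subst2 (bipoly_of g) (bipoly_of h) \o bipoly_of)) => [c|] /=.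
  by rewrite comp_mpolyC !bipoly_ofC subst2C.
apply: ord2P; rewrite comp_mpolyXU ?bipoly_ofX ?bipoly_ofY ?subst2X ?subst2Y //.
Qed.

Lemma coordinateP g : is_coordinate g <-> exists h, coordinate_pair (bipoly_of g) h.
Proof.
split=> [[h [inv K1 K2]]|[h [gx [gy [e1 e2 e3 e4]]]]].
  exists (bipoly_of h); exists (bipoly_of (inv 'X_ord0)), (bipoly_of (inv 'X_ord_max)).
  have ex : subst2 (bipoly_of g) (bipoly_of h) (bipoly_of (inv 'X_ord0)) = 'X%:P.
    by rewrite -bipoly_of_comp K2 bipoly_ofX.
  have ey : subst2 (bipoly_of g) (bipoly_of h) (bipoly_of (inv 'X_ord_max)) = 'X.
    by rewrite -bipoly_of_comp K2 bipoly_ofY.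
  have inj p q : subst2 (bipoly_of g) (bipoly_of h) p = subst2 (bipoly_of g) (bipoly_of h) q -> p = q.
    rewrite -[p]mpoly_of_bipolyK -[q]mpoly_of_bipolyK -!bipoly_of_comp => /(can_inj bipoly_ofK) /(can_inj K1) ->.
    by [].
  by split=> //; apply: inj; rewrite subst2_comp ex ey subst2_id ?subst2X ?subst2Y.
exists (mpoly_of_bipoly h), (fun p => p \mPo [tuple mpoly_of_bipoly gx; mpoly_of_bipoly gy]) => p;
  apply: (can_inj bipoly_ofK); rewrite !bipoly_of_comp !mpoly_of_bipolyK subst2_comp.
  by rewrite e1 e2 subst2_id.
by rewrite e3 e4 subst2_id.
Qed.
End TwoVariables.

Section Transfer.
Variables (k : fieldType) (f : {mpoly k[3]}).
Local Notation M3 := {mpoly k[3]}.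
Local Notation T := {poly {poly {poly k}}}.

Let i0 : 'I_3 := ord0.
Let i1 : 'I_3 := lift ord0 ord0.
Let i2 : 'I_3 := ord_max.

Definition tripoly_of : M3 -> T := mmap (@cst3 k) (tnth [tuple 'X%:P; 'X; polyCC 'X]).
HB.instance Definition _ := GRing.RMorphism.copy tripoly_of
  (mmap (@cst3 k) (tnth [tuple 'X%:P; 'X; polyCC 'X])).

Definition z_tri : {poly k} -> M3 := @eval_map k M3 (@mpolyC 3 k) 'X_i2.
HB.instance Definition _ := GRing.RMorphism.copy z_tri (@eval_map k M3 (@mpolyC 3 k) 'X_i2).
Definition mpoly_of_tripoly : T -> M3 := @eval2 {poly k} M3 z_tri 'X_i0 'X_i1.
HB.instance Definition _ := GRing.RMorphism.copy mpoly_of_tripoly (@eval2 {poly k} M3 z_tri 'X_i0 'X_i1).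

Lemma ord3P (P : 'I_3 -> Prop) : P i0 -> P i1 -> P i2 -> forall i, P i.
Proof.
move=> P0 P1 P2 [[|[|[|//]]] h].
- by rewrite (_ : Ordinal h = i0) //; apply: val_inj.
- by rewrite (_ : Ordinal h = i1) //; apply: val_inj.
- by rewrite (_ : Ordinal h = i2) //; apply: val_inj.
Qed.

Lemma tripoly_ofC c : tripoly_of c%:MP = cst3 c. Proof. by rewrite /tripoly_of mmapC. Qed.
Lemma tripoly_ofX i : tripoly_of 'X_i = tnth [tuple 'X%:P; 'X; polyCC 'X] i.
Proof. by rewrite /tripoly_of mmapX mmap1U. Qed.
Lemma mpoly_of_tripolyC c : mpoly_of_tripoly (cst3 c) = c%:MP.
Proof. by rewrite /mpoly_of_tripoly eval2C /= /z_tri eval_mapC. Qed.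

Lemma mpoly_of_tripolyZ : mpoly_of_tripoly (polyCC 'X) = 'X_i2.
Proof. by rewrite /mpoly_of_tripoly eval2C /= /z_tri eval_mapX. Qed.

Lemma tripoly_ofK p : mpoly_of_tripoly (tripoly_of p) = p.
Proof.
apply: (@mpoly_rmorph_eq 3 k M3 (mpoly_of_tripoly \o tripoly_of) idfun) => [c|] /=.
  by rewrite tripoly_ofC mpoly_of_tripolyC.
apply: ord3P; rewrite tripoly_ofX.
- exact: eval2X.
- exact: eval2Y.
- exact: mpoly_of_tripolyZ.
Qed.

Lemma poly_rmorph_eq (S A : comNzRingType) (r1 r2 : {rmorphism {poly S} -> A}) :
  (forall c, r1 c%:P = r2 c%:P) -> r1 'X = r2 'X -> r1 =1 r2.
Proof.
move=> eC eX; elim/poly_ind => [|p c IH]; first by rewrite !rmorph0.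
by rewrite !rmorphD !rmorphM eX IH eC.
Qed.

Lemma mpoly_of_tripolyK p : tripoly_of (mpoly_of_tripoly p) = p.
Proof.
apply: (@bipoly_rmorph_eq {poly k} T (tripoly_of \o mpoly_of_tripoly) idfun) => [c||] /=.
- apply: (@poly_rmorph_eq k T (tripoly_of \o mpoly_of_tripoly \o (@polyCC {poly k})) (@polyCC {poly k})) => [d|] /=.
    by rewrite mpoly_of_tripolyC tripoly_ofC.
  by rewrite mpoly_of_tripolyZ tripoly_ofX.
- by rewrite /mpoly_of_tripoly eval2X tripoly_ofX.
- by rewrite /mpoly_of_tripoly eval2Y tripoly_ofX.
Qed.

Lemma bipoly_of_eval_z a : bipoly_of (eval_z a f) = map2 (horner_eval a) (tripoly_of f).
Proof.
apply: (@mpoly_rmorph_eq 3 k {poly {poly k}}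
  (@bipoly_of k \o comp_mpoly [tuple 'X_ord0; 'X_ord_max; a%:MP])
  (map2 (horner_eval a) \o tripoly_of)) => [c|] /=.
  by rewrite comp_mpolyC bipoly_ofC tripoly_ofC map2C /= /horner_eval hornerC.
apply: ord3P; rewrite comp_mpolyXU tripoly_ofX /=.
- by rewrite bipoly_ofX; apply/esym/map2X.
- by rewrite bipoly_ofY; apply/esym/map2Y.
- by rewrite bipoly_ofC; apply/esym; rewrite [LHS]map2C /= /horner_eval hornerX.
Qed.

Lemma bipoly_of_as_kz_xy : bipoly_of (as_kz_xy f) = tripoly_of f.
Proof.
apply: (@mpoly_rmorph_eq 3 k T
  (@bipoly_of {poly k} \o mmap (@mpolyC 2 {poly k} \o polyC) (tnth [tuple 'X_ord0; 'X_ord_max; 'X%:MP]))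
  tripoly_of) => [c|] /=.
  by rewrite mmapC /= bipoly_ofC tripoly_ofC.
apply: ord3P; rewrite mmapX mmap1U tripoly_ofX /=.
- exact: bipoly_ofX.
- exact: bipoly_ofY.
- exact: bipoly_ofC.
Qed.
End Transfer.

(** * The surjection given by the isomorphism *)
Section QuotientMap.
Variables (k : fieldType) (f : {mpoly k[3]}).
Variable phi : {rmorphism principal_quot f -> {mpoly k[2]}}.
Hypotheses (phiZ : scalable phi) (phi_bij : bijective phi).
Local Open Scope quotient_scope.

Definition quot_map (g : {mpoly k[3]}) : {mpoly k[2]} := phi (\pi_(principal_quot f) g).

Fact quot_map_zmod : zmod_morphism quot_map.
Proof. by move=> u v; rewrite /quot_map -rmorphB !piE. Qed.

Fact quot_map_monoid : monoid_morphism quot_map.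
Proof.
split=> [|u v]; rewrite /quot_map.
  by rewrite -(rmorph1 phi); congr (phi _); rewrite /GRing.one /= !piE.
rewrite -rmorphM; congr (phi _); rewrite /GRing.mul /= !piE //.
Qed.

HB.instance Definition _ := GRing.isZmodMorphism.Build _ _ quot_map quot_map_zmod.
HB.instance Definition _ := GRing.isMonoidMorphism.Build _ _ quot_map quot_map_monoid.

Lemma quot_mapC c : quot_map c%:MP = c%:MP.
Proof.
have e n : c%:MP = c *: 1 :> {mpoly k[n]} by rewrite -mul_mpolyC mulr1.
rewrite !e -[in RHS](rmorph1 (quot_map : {rmorphism _ -> _})) /= /quot_map -phiZ.
by congr (phi _); rewrite /GRing.scale /= !piE.
Qed.

Lemma quot_map_ker g : quot_map g = 0 <-> exists q, g = q * f.
Proof.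
have e : (quot_map g == 0) = (g \in principal_ideal f).
  rewrite -[g in RHS]subr0 -principal_quotE -(inj_eq (bij_inj phi_bij)).
  by rewrite -[X in _ == X](rmorph0 (quot_map : {rmorphism _ -> _})).
split=> [/eqP|/principal_idealP]; first by rewrite e => /principal_idealP.
by rewrite -e => /eqP.
Qed.

Lemma quot_map_surj w : exists g, quot_map g = w.
Proof.
have [inv K1 K2] := phi_bij; exists (repr (inv w)).
by rewrite /quot_map reprK K2.
Qed.
End QuotientMap.

Theorem proposition3p1 (k : fieldType) (char0 : [pchar k] =i pred0)
    (f : {mpoly k[3]})
    (A_iso : quot_iso_alg f {mpoly k[2]})
    (coord_a : exists a : k, is_coordinate (eval_z a f)) :
  is_coordinate (as_kz_xy f).
Proof.
have [phi [phiZ phi_bij]] := A_iso.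
have [a /coordinateP[h coord]] := coord_a; rewrite bipoly_of_eval_z in coord.
apply/coordinateP; rewrite bipoly_of_as_kz_xy.
have [Psi PsiE] : exists Psi : {rmorphism {poly {poly {poly k}}} -> {poly {poly k}}},
    forall W, Psi W = bipoly_of (quot_map phi (mpoly_of_tripoly W)).
  by exists (@bipoly_of k \o quot_map phi \o @mpoly_of_tripoly k).
have PsiC c : Psi (polyCC c%:P) = polyCC c.
  by rewrite PsiE -[polyCC _]/(cst3 c) mpoly_of_tripolyC quot_mapC // bipoly_ofC.
have Psi_surj w : exists W, Psi W = w.
  have [g eg] := quot_map_surj phi_bij (mpoly_of_bipoly w).
  by exists (tripoly_of g); rewrite PsiE tripoly_ofK eg mpoly_of_bipolyK.
have Psi_ker W : Psi W = 0 <-> exists q, W = q * tripoly_of f.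
  rewrite PsiE; split=> [e|[q ->]].
    have /(quot_map_ker phi_bij)[q eq] : quot_map phi (mpoly_of_tripoly W) = 0.
      by apply: (can_inj (@bipoly_ofK k)); rewrite e rmorph0.
    exists (tripoly_of q); have <- : tripoly_of (q * f) = tripoly_of q * tripoly_of f by apply: rmorphM.
    by rewrite -eq mpoly_of_tripolyK.
  have -> : mpoly_of_tripoly (q * tripoly_of f) = mpoly_of_tripoly q * f.
    by rewrite -[f in RHS]tripoly_ofK; apply: rmorphM.
  rewrite (_ : quot_map phi (mpoly_of_tripoly q * f) = 0); first exact: rmorph0.
  by apply/(quot_map_ker phi_bij); exists (mpoly_of_tripoly q).
have [X [Y [H [gen ker]]]] := family_of_lines char0 PsiC Psi_surj Psi_ker coord.
have [h' coord'] := family_coordinate char0 gen ker.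
by exists h'.
Qed.
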